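(* Let $A$ be a unital $C^*$-algebra, $\alpha$ a unital $*$-endomorphism of $A$ (i.e. $\alpha(1)=1$), and $n\ge1$. Then $C^*_{\mathrm{env}}(A\times_\alpha\mathcal T_n^+)\simeq A\times_\alpha^n\mathbb N$.
   Context: A family $\{T_i\}_{i=1}^n\subseteq\mathcal B(H)$ is a Toeplitz-Cuntz family if the $T_i$ are isometries with orthogonal ranges, $\sum_iT_iT_i^*\le I$. For a word $\mu=i_1\cdots i_k\in\mathbb F_n^+$ (free semigroup), $T_\mu=T_{i_1}\cdots T_{i_k}$. Consider pairs $(\pi,\{T_i\}_{i=1}^n)$ where $\pi:A\to\mathcal B(H)$ is a $*$-representation, $\{T_i\}$ is a Toeplitz-Cuntz family on $H$, and $\pi(\alpha(x))=\sum_{i=1}^nT_i\pi(x)T_i^*$ for all $x\in A$. Since $\alpha(1)=1$, it is the convention that $\pi$ is taken unital (non-degenerate); then $\sum_iT_iT_i^*=I$. $A\times_\alpha\mathcal T_n^+$ is the universal (norm-closed, non-selfadjoint) operator algebra relative to this class of pairs, generated by $\pi(x)$ and $T_\mu$, $x\in A$, $\mu\in\mathbb F_n^+$ (matrix norms are suprema over all pairs). $A\times_\alpha^n\mathbb N$ (Stacey's multiplicity $n$ crossed product) is the universal $C^*$-algebra generated by $\pi(A)T_\nu T_\mu^*$ for pairs $(\pi,\{T_i\}_{i=1}^n)$ where $\pi:A\to\mathcal B(H)$ is a non-degenerate $*$-representation, $\{T_i\}$ is a Toeplitz-Cuntz family on $H$, and $\pi(\alpha(x))=\sum_{i=1}^nT_i\pi(x)T_i^*$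 for all $x\in A$. $C^*$-envelope: for an operator algebra $\mathcal A$, a $C^*$-cover is a pair $(\mathcal C,\rho)$ with $\rho:\mathcal A\to\mathcal C$ a completely isometric homomorphism and $\mathcal C=C^*(\rho(\mathcal A))$. $C^*_{\mathrm{env}}(\mathcal A)$ is the smallest $C^*$-cover: every $C^*$-cover $(\mathcal C,\rho)$ admits a unique $*$-epimorphism $\mathcal C\to C^*_{\mathrm{env}}(\mathcal A)$ compatible with the copies of $\mathcal A$. The isomorphism $\simeq$ is the canonical one (generators to generators of the same index). *)

(* Defs.v *)
From HB Require Import structures.
From mathcomp Require Import all_boot all_order all_algebra.
From mathcomp Require Import all_classical all_reals.
From mathcomp Require Import topology normedtype.
From mathcomp Require Import complex.

Set Implicit Arguments.
Unset Strict Implicit.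
Unset Printing Implicit Defensive.

Import Order.TTheory GRing.Theory Num.Theory.
Import numFieldNormedType.Exports.

Local Open Scope classical_set_scope.
Local Open Scope ring_scope.
Local Open Scope complex_scope.

(* Norms on a [normedModType R[i]] are [R[i]]-valued; [nrm] is the same norm,
   valued in [R], so that suprema can be taken. *)
Definition nrm (R : realType) (V : normedModType R[i]) (x : V) : R :=
  complex.Re `|x|.

(* The inner product is linear in its first variable.  Positivity and
   definiteness follow from [dot_norm]. *)
HB.mixin Record CompleteNormedModule_isHilbert (R : realType) H
    of CompleteNormedModule R[i] H := {
  dot : H -> H -> R[i];
  dot_linear : forall z (a : R[i]) x y,
    dot (a *: x + y) z = a * dot x z + dot y z;
  dot_conj : forall x y, dot y x = (dot x y)^*;
  dot_norm : forall x, dot x x = `|x| ^+ 2 }.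

#[short(type="hilbertType")]
HB.structure Definition Hilbert (R : realType) :=
  {H of CompleteNormedModule_isHilbert R H & CompleteNormedModule R[i] H}.

Section Operators.
Context {R : realType} {H : hilbertType R}.

Definition bounded_op (f : H -> H) : Prop :=
  linear f /\ exists M : R, forall h, nrm (f h) <= M * nrm h.

Definition is_adjoint (f g : H -> H) : Prop :=
  forall x y, dot (f x) y = dot x (g y).

(* Every bounded operator has exactly one adjoint (Riesz); [adjoint f] is
   meaningful only for such [f]. *)
Definition adjoint (f : H -> H) : H -> H := get (is_adjoint f).

(* The norm of M_k(B(H)) = B(H^k), with H^k the Hilbert space direct sum. *)
Definition opmx_norm k (a : 'M[H -> H]_k) : R :=
  sup [set Num.sqrt (\sum_i nrm (\sum_j a i j (h j)) ^+ 2)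
      | h in [set h : 'I_k -> H | \sum_j nrm (h j) ^+ 2 <= 1]].

Definition op_norm (f : H -> H) : R := opmx_norm (const_mx f : 'M_1).

Definition toeplitz_cuntz n (T : 'I_n -> H -> H) : Prop :=
  [/\ forall i, bounded_op (T i),
      forall i h, `|T i h| = `|h|,
      forall i j, i != j -> forall h k, dot (T i h) (T j k) = 0
    & forall h, dot (\sum_i T i (adjoint (T i) h)) h <= dot h h].

End Operators.

(* None of the algebras is required to be unital or nonzero, hence the product
   is not that of a MathComp [algType]. *)
HB.mixin Record CompleteNormedModule_isBanachAlg (R : realType) A
    of CompleteNormedModule R[i] A := {
  bmul : A -> A -> A;
  bmulA : associative bmul;
  bmul_linearl : forall y, linear (bmul^~ y);
  bmul_linearr : forall x, linear (bmul x);
  bmul_norm : forall x y, `|bmul x y| <= `|x| * `|y| }.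

#[short(type="banachAlgType")]
HB.structure Definition BanachAlg (R : realType) :=
  {A of CompleteNormedModule_isBanachAlg R A & CompleteNormedModule R[i] A}.

HB.mixin Record BanachAlg_isCstarAlg (R : realType) A of BanachAlg R A := {
  star : A -> A;
  starK : involutive star;
  star_linear : forall (a : R[i]) x y,
    star (a *: x + y) = a^* *: star x + star y;
  star_bmul : forall x y, star (bmul x y) = bmul (star y) (star x);
  cstar_identity : forall x, `|bmul (star x) x| = `|x| ^+ 2 }.

#[short(type="cstarAlgType")]
HB.structure Definition CstarAlg (R : realType) :=
  {A of BanachAlg_isCstarAlg R A & BanachAlg R A}.

Section Representations.
Context {R : realType} {H : hilbertType R}.

Definition alg_rep (A : banachAlgType R) (f : A -> H -> H) : Prop :=
  [/\ forall x, bounded_op (f x),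
      forall h, linear (f^~ h)
    & forall x y h, f (bmul x y) h = f x (f y h)].

Definition star_rep (A : cstarAlgType R) (f : A -> H -> H) : Prop :=
  alg_rep f /\ forall x, is_adjoint (f x) (f (star x)).

End Representations.

(* An operator algebra: a Banach algebra with matrix norms that is, completely
   isometrically, a (necessarily norm-closed) subalgebra of some B(H). *)
HB.mixin Record BanachAlg_isOpAlg (R : realType) A of BanachAlg R A := {
  mxnorm : forall k, 'M[A]_k -> R;
  mxnorm1 : forall x : A, mxnorm 1 (const_mx x) = nrm x;
  opalg_concrete : exists (H : hilbertType R) (f : A -> H -> H),
    alg_rep f /\ forall k (a : 'M[A]_k), mxnorm k a = opmx_norm (map_mx f a) }.

#[short(type="opAlgType")]
HB.structure Definition OpAlg (R : realType) :=
  {A of BanachAlg_isOpAlg R A & BanachAlg R A}.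

(* The norm of the C*-algebra M_k(C), as a supremum over the *-representations
   of C on Hilbert spaces. *)
Definition cstar_mxnorm (R : realType) (C : cstarAlgType R) k (c : 'M[C]_k)
    : R :=
  sup [set r | exists (H : hilbertType R) (f : C -> H -> H),
    star_rep f /\ r = opmx_norm (map_mx f c)].

Definition is_unit (R : realType) (A : banachAlgType R) (e : A) : Prop :=
  forall x, bmul e x = x /\ bmul x e = x.

Definition alg_hom (R : realType) (A B : banachAlgType R) (f : A -> B)
    : Prop :=
  linear f /\ forall x y, f (bmul x y) = bmul (f x) (f y).

Definition star_hom (R : realType) (A B : cstarAlgType R) (f : A -> B)
    : Prop :=
  alg_hom f /\ forall x, f (star x) = star (f x).

Definition subalgebra (R : realType) (A : banachAlgType R) (S : set A)
    : Prop :=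
  [/\ S 0, forall (a : R[i]) x y, S x -> S y -> S (a *: x + y)
    & forall x y, S x -> S y -> S (bmul x y)].

Definition star_subalgebra (R : realType) (A : cstarAlgType R) (S : set A)
    : Prop :=
  subalgebra S /\ forall x, S x -> S (star x).

Definition opalg_generated (R : realType) (A : banachAlgType R) (G : set A)
    : Prop :=
  forall S : set A, closed S -> subalgebra S -> G `<=` S -> S = setT.

Definition cstar_generated (R : realType) (A : cstarAlgType R) (G : set A)
    : Prop :=
  forall S : set A, closed S -> star_subalgebra S -> G `<=` S -> S = setT.

Definition cstar_cover (R : realType) (A : opAlgType R) (C : cstarAlgType R)
    (rho : A -> C) : Prop :=
  [/\ alg_hom rho,
      forall k (a : 'M[A]_k), cstar_mxnorm (map_mx rho a) = mxnorm k a
    & cstar_generated (range rho)].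

Definition cstar_envelope (R : realType) (A : opAlgType R)
    (E : cstarAlgType R) (eps : A -> E) : Prop :=
  cstar_cover eps /\
  forall (C : cstarAlgType R) (rho : A -> C), cstar_cover rho ->
    exists! Phi : C -> E,
      [/\ star_hom Phi, range Phi = setT & forall a, Phi (rho a) = eps a].

Section CrossedProducts.
Context {R : realType} {A : cstarAlgType R}.
Context (one : A) (alpha : A -> A) (n : nat).

(* As A is unital, non-degeneracy of [pi] means that pi(1) = I. *)
Definition covariant_pair (H : hilbertType R)
    (pi : A -> H -> H) (T : 'I_n -> H -> H) : Prop :=
  [/\ star_rep pi, forall h, pi one h = h, toeplitz_cuntz T
    & forall x h, pi (alpha x) h = \sum_i T i (pi x (adjoint (T i) h))].

(* t_mu = t_(i_1) ... t_(i_k) for the word mu = i_1 ... i_k, where [e] is the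
   value at the empty word. *)
Definition word (B : banachAlgType R) (e : B) (t : 'I_n -> B)
    (mu : seq 'I_n) : B :=
  foldr (fun i y => bmul (t i) y) e mu.

Definition cc_rep (B : opAlgType R) (H : hilbertType R) (f : B -> H -> H)
    : Prop :=
  alg_rep f /\
  forall k (b : 'M[B]_k), opmx_norm (map_mx f b) <= mxnorm k b.

(* By the second clause every covariant pair is of the form
   (f \o iota, f \o t), so the suprema in the third clause, and in
   [stacey_crossed_product], run over all covariant pairs. *)
Definition tensor_crossed_product (B : opAlgType R)
    (iota : A -> B) (t : 'I_n -> B) : Prop :=
  [/\ opalg_generated (range iota `|` range (word (iota one) t)),
      forall (H : hilbertType R) (pi : A -> H -> H) (T : 'I_n -> H -> H),
        covariant_pair pi T ->
        exists f : B -> H -> H,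
          [/\ cc_rep f, forall x, f (iota x) = pi x & forall i, f (t i) = T i]
    & forall k (b : 'M[B]_k), mxnorm k b =
        sup [set r | exists (H : hilbertType R) (f : B -> H -> H),
          [/\ cc_rep f, covariant_pair (f \o iota) (f \o t)
            & r = opmx_norm (map_mx f b)]]].

Definition stacey_crossed_product (B : cstarAlgType R)
    (j : A -> B) (s : 'I_n -> B) : Prop :=
  [/\ cstar_generated [set b | exists x nu mu,
        b = bmul (bmul (j x) (word (j one) s nu))
                 (star (word (j one) s mu))],
      forall (H : hilbertType R) (pi : A -> H -> H) (T : 'I_n -> H -> H),
        covariant_pair pi T ->
        exists f : B -> H -> H,
          [/\ star_rep f, forall x, f (j x) = pi x & forall i, f (s i) = T i]
    & forall b : B, nrm b =
        sup [set r | exists (H : hilbertType R) (f : B -> H -> H),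
          [/\ star_rep f, covariant_pair (f \o j) (f \o s)
            & r = op_norm (f b)]]].

End CrossedProducts.

(* Main.v *)
(* Every covariant pair consists of a *-representation pi and a row unitary
   (T_1, ..., T_n), because alpha(1) = 1.  Such pairs are rigid: let C be a
   C*-cover of the tensor algebra, sg a representation of C and V an isometry
   such that V^* sg(.) V extends a covariant representation of the tensor
   algebra.  Then sg(t_i) V = V T_i and sg(t_i)^* V = V T_i^*, since isometric
   columns and coisometric rows can only be compressed from contractions
   trivially; likewise for an element x of A, which for |x| < 1 is an entry of
   an isometric column (x, d) and of a coisometric row, d^* d = 1 - x^* x.
   Hence |q|_B <= |q|_C for every *-polynomial q in the generators, which gives
   the *-homomorphism C -> B.

   Arveson's extension theorem is not needed to find V: for finitely many
   vectors and finitely many elements of the tensor algebra, an approximate V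
   comes from separating a point from a convex cone in R^m, where a separating
   functional would be an element a of a matrix algebra whose numerical range
   in C violates complete isometry at 1 + e a for small e > 0. *)

Require Import Defs.
From HB Require Import structures.
From mathcomp Require Import all_boot all_order all_algebra.
From mathcomp Require Import all_classical all_reals.
From mathcomp Require Import topology normedtype.
From mathcomp Require Import complex ring lra.

Set Implicit Arguments.
Unset Strict Implicit.
Unset Printing Implicit Defensive.

Import Order.TTheory GRing.Theory Num.Theory.
Import numFieldNormedType.Exports.

Local Open Scope classical_set_scope.
Local Open Scope ring_scope.
Local Open Scope complex_scope.

(** * Norms and limits *)

(** The vectors that imitate those of [H] in representations of [C] depend on a finite list of
    coefficients and a tolerance, so the compression [V] exists only as a limit along such data: it
    is a bare function, and its linearity and isometry are themselves limit statements. Both maps,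
    from the tensor algebra to [B] and from [C] to [B], are obtained as relations that are
    contractive, closed and compatible with the operations; completeness of [B] then extends them
    from the generators to all elements. A star-homomorphism [C -> B] extending the inclusion has
    dense range, but the envelope asks for a surjection, so the range must be shown closed. For
    this, for the contractivity of representations and for the defect [d], one fixed point theorem
    takes the place of functional calculus: a quadratic equation gives square roots and a damped
    linear one gives resolvents. Representations of [C] may be degenerate; the unit of the tensor
    algebra acts in them as a projection. *)

Section ScalarNorm.
Context {R : realType} {V : normedModType R[i]}.
Implicit Types (x y : V) (a : R[i]).

Lemma normE x : `|x| = (nrm x)%:C.
Proof. by rewrite /nrm RRe_real // ger0_real. Qed.

Lemma nrm_ge0 x : 0 <= nrm x.
Proof. by rewrite -ler0c -normE. Qed.

Lemma nrm0 : nrm (0 : V) = 0.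
Proof. by rewrite /nrm normr0. Qed.

Lemma nrm0_eq0 x : nrm x = 0 -> x = 0.
Proof. by move=> x0; apply/eqP; rewrite -normr_eq0 normE x0. Qed.

Lemma nrmD x y : nrm (x + y) <= nrm x + nrm y.
Proof. by rewrite -lecR rmorphD /= -!normE ler_normD. Qed.

Lemma nrmN x : nrm (- x) = nrm x.
Proof. by rewrite /nrm normrN. Qed.

Lemma nrmB x y : nrm (x - y) <= nrm x + nrm y.
Proof. by rewrite -(nrmN y) nrmD. Qed.

Lemma nrmC x y : nrm (x - y) = nrm (y - x).
Proof. by rewrite -nrmN opprB. Qed.

Lemma nrm_trans z x y : nrm (x - y) <= nrm (x - z) + nrm (z - y).
Proof. by rewrite (le_trans _ (nrmD _ _)) // addrA subrK. Qed.

Lemma nrmZ a x : nrm (a *: x) = complex.Re `|a| * nrm x.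
Proof.
by apply: complexI; rewrite rmorphM /= -!normE normrZ.
Qed.

Lemma nrmZr (c : R) x : nrm (c%:C *: x) = `|c| * nrm x.
Proof. by rewrite nrmZ normc_def /= expr0n addr0 sqrtr_sqr. Qed.

Lemma nrm_eqP x y : (forall e, 0 < e -> nrm (x - y) <= e) -> x = y.
Proof.
move=> xy; apply/eqP; rewrite -subr_eq0; apply/eqP/nrm0_eq0/eqP.
by rewrite eq_le nrm_ge0 andbT; apply/ler_addgt0Pl => e /xy; rewrite addr0.
Qed.

Lemma closed_nrm (S : set V) :
  (forall x, (forall e, 0 < e -> exists2 y, S y & nrm (x - y) < e) -> S x) ->
  closed S.
Proof.
move=> h x Sx; apply: h => e e0.
have [] := Sx (ball_ Num.norm x e%:C).
  by apply/nbhs_normP; exists e%:C => //=; rewrite ltcR.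
by move=> y [Sy]; rewrite /ball_ /= normE ltcR => xy; exists y.
Qed.

End ScalarNorm.

(** Bernoulli's inequality for [q^-1 = 1 + d] gives [q^-k >= 1 + k d], so any [k >= M / (e d)]
    works. *)
Lemma small_expr (R : realType) (q M e : R) : 0 <= q < 1 -> 0 <= M -> 0 < e ->
  exists n, forall k, (n <= k)%N -> M * q ^+ k <= e.
Proof.
move=> /andP[q0 q1] M0 e0; case: (eqVneq q 0) => [->|qn0].
  (* Not 0, since [0 ^+ 0 = 1]. *)
  by exists 1%N => -[//|k] _; rewrite exprS mul0r mulr0 ltW.
have qp : 0 < q by rewrite lt_def qn0.
have d0 : 0 < q^-1 - 1 by rewrite subr_gt0 invf_gt1.
set d := q^-1 - 1 in d0.
have bern k : 1 + k%:R * d <= q^-1 ^+ k.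
  elim: k => [|k ih]; first by rewrite mul0r addr0 expr0.
  rewrite exprS -natr1; apply: le_trans (ler_wpM2l _ ih); last first.
    by rewrite invr_ge0.
  have -> : q^-1 = 1 + d by rewrite /d addrC subrK.
  rewrite -subr_ge0 [X in 0 <= X](_ : _ = k%:R * (d * d)); last by ring.
  by rewrite mulr_ge0 // mulr_ge0 // ltW.
exists (Num.trunc (M / (e * d))).+1 => k nk.
have hk : M / (e * d) <= k%:R.
  apply: le_trans (_ : (Num.trunc (M / (e * d))).+1%:R <= _).
    exact/ltW/truncnS_gt.
  by rewrite ler_nat.
have qk : 0 < q ^+ k by rewrite exprn_gt0.
rewrite -ler_pdivlMr // -exprVn.
move: hk; rewrite ler_pdivrMr ?mulr_gt0 // => hk.
rewrite (le_trans hk) // mulrCA ler_pM2l //.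
by rewrite (le_trans _ (bern k)) // lerDr.
Qed.

Lemma geometric_limit (R : realType) (V : completeNormedModType R[i])
    (u : nat -> V) (M q : R) : 0 <= M -> 0 <= q < 1 ->
  (forall k, nrm (u k.+1 - u k) <= M * q ^+ k) ->
  exists l, forall k, nrm (l - u k) <= M / (1 - q) * q ^+ k.
Proof.
move=> M0 /andP[q0 q1] uM.
have q1' : 0 < 1 - q by rewrite subr_gt0.
have K0 : 0 <= M / (1 - q) by rewrite divr_ge0 // ltW.
have qk k : 0 <= q ^+ k by rewrite exprn_ge0.
(* Keeping the term [q ^+ (k + j)] lets the induction on [j] close with equality. *)
have uD k j : nrm (u (k + j)%N - u k) <= M / (1 - q) * (q ^+ k - q ^+ (k + j)).
  elim: j => [|j ih]; first by rewrite addn0 !subrr nrm0 mulr0.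
  rewrite addnS (le_trans (nrm_trans (u (k + j)%N) _ _)) //.
  rewrite (le_trans (lerD (uM _) ih)) //.
  rewrite -subr_ge0 [X in 0 <= X](_ : _ = 0) // exprS.
  by field; rewrite gt_eqF.
have uC k j : nrm (u (k + j)%N - u k) <= M / (1 - q) * q ^+ k.
  by rewrite (le_trans (uD k j)) // ler_wpM2l // lerBlDr lerDl.
have cu : cauchy (u @ \oo).
  apply: cauchy_exP => e e0.
  have eE : e = (complex.Re e)%:C by rewrite RRe_real // gtr0_real.
  have e0' : 0 < complex.Re e by rewrite -ltcR -eE.
  have e2 : 0 < complex.Re e / 2 by rewrite divr_gt0.
  have [||n hn] := @small_expr _ q (M / (1 - q)) _ _ _ e2 => //.
    by rewrite q0.
  exists (u n); exists n => // k /= nk.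
  rewrite -ball_normE /ball_ /= normE eE ltcR nrmC.
  rewrite -(subnKC nk) (le_lt_trans (uC _ _)) // (le_lt_trans (hn n _)) //.
  by rewrite ltr_pdivrMr // ltr_pMr // ltr1n.
have /cauchy_cvgP /cvg_ex [l ul] := cu.
exists l => k; apply/ler_addgt0Pl => e e0.
have /cvgrPdist_le/(_ e%:C) := ul; rewrite ltcR => /(_ e0) [n _ hn].
rewrite (le_trans (nrm_trans (u (k + n)%N) _ _)) // lerD //.
by have /= := hn (k + n)%N (leq_addl _ _); rewrite normE lecR.
Qed.

(** Banach's fixed point theorem on a closed invariant set [S]: the quadratic map behind
    [quasi_sqrt] is a contraction only on a ball. *)
Lemma contraction_fixpoint (R : realType) (V : completeNormedModType R[i])
    (F : V -> V) (S : set V) (q : R) : 0 <= q < 1 -> S 0 ->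
  (forall x, S x -> S (F x)) ->
  (forall x, (forall e, 0 < e -> exists2 y, S y & nrm (x - y) < e) -> S x) ->
  (forall x y, S x -> S y -> nrm (F x - F y) <= q * nrm (x - y)) ->
  exists2 x, S x & F x = x.
Proof.
move=> q01 S0 SF cS Fq; have /andP[q0 q1] := q01.
pose u k := iter k F 0.
have Su k : S (u k) by elim: k => //= k; exact: SF.
have [|l hl] := @geometric_limit _ _ u (nrm (F 0)) q (nrm_ge0 _) q01.
  elim=> [|k ih]; first by rewrite subr0 expr0 mulr1.
  apply: le_trans (Fq _ _ (Su k.+1) (Su k)) _.
  by rewrite exprS mulrCA ler_wpM2l.
have lu e : 0 < e -> exists n, forall k, (n <= k)%N -> nrm (l - u k) < e.
  move=> e0; have [||n hn] := @small_expr _ q (nrm (F 0) / (1 - q)) (e / 2) q01.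
  - by rewrite divr_ge0 ?nrm_ge0 // subr_ge0 ltW.
  - by rewrite divr_gt0.
  exists n => k nk; rewrite (le_lt_trans (hl k)) // (le_lt_trans (hn k nk)) //.
  by rewrite ltr_pdivrMr // ltr_pMr // ltr1n.
have Sl : S l by apply: cS => e /lu [n hn]; exists (u n); [|exact: hn].
exists l => //; apply: nrm_eqP => e e0.
have e2 : 0 < e / 2 by rewrite divr_gt0.
have [n hn] := lu _ e2.
have h1 : nrm (F l - u n.+1) <= e / 2.
  apply: le_trans (Fq _ _ Sl (Su n)) (le_trans _ (ltW (hn n _))) => //.
  by rewrite ler_piMl ?nrm_ge0 // ltW.
have h2 : nrm (u n.+1 - l) <= e / 2 by rewrite nrmC ltW // hn.
rewrite (le_trans (nrm_trans (u n.+1) _ _)) //.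
by rewrite (le_trans (lerD h1 h2)) // -splitr.
Qed.

(** * Inner products *)

(** Splits the intertwining defect of a linear combination, in [asym_lin], into the two given
    defects and the failures of homogeneity and additivity. *)
Lemma sub_telescope (V : zmodType) (x y z u v w : V) :
  x + z - v = x - y + (z - w) + (y - u + (u + w - v)).
Proof.
rewrite -[u + w - v]addrA [y - u + _]addrA subrK addrACA subrK.
by rewrite [z - w + _]addrA subrK addrA.
Qed.

Section LinearFunctions.
Context {K : nzRingType} {U V : lmodType K} {f : U -> V}.
Hypothesis lf : linear f.

Lemma linfD x y : f (x + y) = f x + f y.
Proof. by have := lf 1 x y; rewrite !scale1r. Qed.

Lemma linf0 : f 0 = 0.
Proof. by apply: (@addrI _ (f 0)); rewrite -linfD !addr0. Qed.

Lemma linfZ a x : f (a *: x) = a *: f x.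
Proof. by have := lf a x 0; rewrite linf0 !addr0. Qed.

Lemma linfN x : f (- x) = - f x.
Proof. by rewrite -scaleN1r linfZ scaleN1r. Qed.

Lemma linfB x y : f (x - y) = f x - f y.
Proof. by rewrite linfD linfN. Qed.

Lemma linf_sum I r (P : pred I) (F : I -> U) :
  f (\sum_(i <- r | P i) F i) = \sum_(i <- r | P i) f (F i).
Proof. exact: (big_morph f linfD linf0). Qed.

End LinearFunctions.

Section InnerProduct.
Context {R : realType} {H : hilbertType R}.
Implicit Types (x y z : H) (a : R[i]).

(** Separation in [R^m] needs real functionals; imaginary parts come back through scalar multiples
    of the elements, as in [tends_gramC]. *)
Definition rdot x y : R := complex.Re (dot x y).

Lemma dot_linearl z : linear ((dot (s := H))^~ z : H -> R[i]^o).
Proof. exact: dot_linear. Qed.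

Lemma dotDl x y z : dot (x + y) z = dot x z + dot y z.
Proof. exact: (linfD (dot_linearl z)). Qed.

Lemma dotZl a x y : dot (a *: x) y = a * dot x y.
Proof. exact: (linfZ (dot_linearl y)). Qed.

Lemma dotNl x y : dot (- x) y = - dot x y.
Proof. exact: (linfN (dot_linearl y)). Qed.

Lemma rdot_nrm x : rdot x x = nrm x ^+ 2.
Proof. by rewrite /rdot dot_norm normE -rmorphXn. Qed.

Lemma rdotC x y : rdot x y = rdot y x.
Proof. by rewrite /rdot dot_conj; case: (dot y x). Qed.

Lemma rdotDl x y z : rdot (x + y) z = rdot x z + rdot y z.
Proof. by rewrite /rdot dotDl; case: (dot x z) => ? ?; case: (dot y z). Qed.

Lemma rdotNl x y : rdot (- x) y = - rdot x y.
Proof. by rewrite /rdot dotNl; case: (dot x y). Qed.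

Lemma rdotBl x y z : rdot (x - y) z = rdot x z - rdot y z.
Proof. by rewrite rdotDl rdotNl. Qed.

Lemma rdotDr x y z : rdot x (y + z) = rdot x y + rdot x z.
Proof. by rewrite rdotC rdotDl !(rdotC x). Qed.

Lemma rdotNr x y : rdot x (- y) = - rdot x y.
Proof. by rewrite rdotC rdotNl rdotC. Qed.

Lemma rdotBr x y z : rdot x (y - z) = rdot x y - rdot x z.
Proof. by rewrite rdotDr rdotNr. Qed.

Lemma rdotZl (c : R) x y : rdot (c%:C *: x) y = c * rdot x y.
Proof.
by rewrite /rdot dotZl; case: (dot x y) => u v /=; rewrite mul0r subr0.
Qed.

Lemma rdotZr (c : R) x y : rdot x (c%:C *: y) = c * rdot x y.
Proof. by rewrite rdotC rdotZl rdotC. Qed.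

Lemma rdot0l x : rdot 0 x = 0.
Proof. by rewrite -(subrr x) rdotBl subrr. Qed.

Lemma rdot_suml I r (P : pred I) (F : I -> H) y :
  rdot (\sum_(i <- r | P i) F i) y = \sum_(i <- r | P i) rdot (F i) y.
Proof.
by apply: (big_morph (fun x => rdot x y)) => [u v|]; rewrite ?rdotDl ?rdot0l.
Qed.

Lemma rdot_sumr I r (P : pred I) (F : I -> H) y :
  rdot y (\sum_(i <- r | P i) F i) = \sum_(i <- r | P i) rdot y (F i).
Proof. by rewrite rdotC rdot_suml; apply: eq_bigr => i _; rewrite rdotC. Qed.

Lemma nrm2D x y : nrm (x + y) ^+ 2 = nrm x ^+ 2 + 2 * rdot x y + nrm y ^+ 2.
Proof. by rewrite -!rdot_nrm rdotDl !rdotDr (rdotC y x); ring. Qed.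

Lemma nrm2B x y : nrm (x - y) ^+ 2 = nrm x ^+ 2 - 2 * rdot x y + nrm y ^+ 2.
Proof. by rewrite nrm2D rdotNr nrmN mulrN. Qed.

Lemma rdot_le x y : rdot x y <= nrm x ^+ 2 + nrm y ^+ 2.
Proof.
have := sqr_ge0 (nrm (x - y)); rewrite nrm2B.
by have := sqr_ge0 (nrm x); have := sqr_ge0 (nrm y); lra.
Qed.

Lemma rdot_cs x y : rdot x y <= nrm x * nrm y.
Proof.
have [y0|y0] := eqVneq (nrm y) 0.
  by move/nrm0_eq0: (y0) => ->; rewrite rdotC rdot0l nrm0 mulr0.
have yp : 0 < nrm y by rewrite lt_def y0 nrm_ge0.
have := sqr_ge0 (nrm ((nrm y)%:C *: x - (nrm x)%:C *: y)).
rewrite nrm2B rdotZl rdotZr !nrmZr !ger0_norm ?nrm_ge0 // => h.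
have [x0|x0] := eqVneq (nrm x) 0.
  by move/nrm0_eq0: (x0) => ->; rewrite rdot0l nrm0 mul0r.
have xp : 0 < nrm x by rewrite lt_def x0 nrm_ge0.
rewrite -subr_ge0 -(pmulr_rge0 _ (mulr_gt0 xp yp)).
by move: h; lra.
Qed.

Lemma dot_injl x y : (forall z, dot x z = dot y z) -> x = y.
Proof.
move=> xy; apply/eqP; rewrite -subr_eq0; apply/eqP/nrm0_eq0.
apply/eqP; rewrite -sqrf_eq0 -rdot_nrm /rdot dotDl dotNl xy subrr.
by [].
Qed.

Lemma dot_injr x y : (forall z, dot z x = dot z y) -> x = y.
Proof. by move=> xy; apply: dot_injl => z; rewrite dot_conj xy -dot_conj. Qed.

Lemma adjoint_unique (f g : H -> H) : is_adjoint f g -> adjoint f = g.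
Proof.
move=> fg; apply/funext => x; apply: dot_injr => z; rewrite -fg.
by rewrite -(getPex (ex_intro (is_adjoint f) g fg)).
Qed.

Lemma is_adjoint_sym (f g : H -> H) : is_adjoint f g -> is_adjoint g f.
Proof. by move=> fg x y; rewrite dot_conj -fg -dot_conj. Qed.

Lemma rdot_adj (f g : H -> H) x y : is_adjoint f g ->
  rdot (f x) y = rdot x (g y).
Proof. by move=> fg; rewrite /rdot fg. Qed.

Lemma adjoint_bound (f g : H -> H) L x : is_adjoint f g -> 0 <= L ->
  (forall y, nrm (f y) <= L * nrm y) -> nrm (g x) <= L * nrm x.
Proof.
move=> fg L0 fL; have [g0|g0] := eqVneq (nrm (g x)) 0.
  by rewrite g0 mulr_ge0 ?nrm_ge0.
have gp : 0 < nrm (g x) by rewrite lt_def g0 nrm_ge0.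
rewrite -(ler_pM2r gp) -expr2 -rdot_nrm -(rdot_adj _ _ fg).
by rewrite (le_trans (rdot_cs _ _)) // mulrAC ler_wpM2r ?nrm_ge0.
Qed.

(** For [u] in the range and [v] in the kernel, |u| = |p (u + t v)| <= |u + t v| for all real [t],
    which forces [rdot u v = 0]; so [p] is an orthogonal projection. *)
Lemma contractive_idempotent_adj (p : H -> H) : linear p ->
  (forall x, p (p x) = p x) -> (forall x, nrm (p x) <= nrm x) ->
  forall x y, rdot (p x) y = rdot x (p y).
Proof.
move=> lp pp p1.
have orth x y : rdot (p x) (y - p y) = 0.
  set u := p x; set v := y - p y.
  have key t : 0 <= 2 * t * rdot u v + t ^+ 2 * nrm v ^+ 2.
    have := p1 (u + t%:C *: v).
    rewrite linfD // linfZ // /v linfB // pp subrr scaler0 addr0 pp -/u -/v.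
    rewrite -(ler_sqr (nrm_ge0 _) (nrm_ge0 _)) nrm2D rdotZr nrmZr exprMn.
    by rewrite real_normK ?num_real //; lra.
  have [v0|v0] := eqVneq (nrm v) 0.
    by move/nrm0_eq0: v0 => ->; rewrite rdotC rdot0l.
  have v2 : 0 < nrm v ^+ 2 by rewrite exprn_even_gt0.
  (* The minimiser in [t] of the quadratic polynomial of [key]. *)
  have := key (- rdot u v / nrm v ^+ 2).
  rewrite [X in 0 <= X](_ : _ = - (rdot u v ^+ 2 / nrm v ^+ 2)); last first.
    by field; rewrite v0.
  rewrite oppr_ge0 pmulr_lle0 ?invr_gt0 // => uv0.
  by apply/eqP; rewrite -sqrf_eq0 eq_le uv0 sqr_ge0.
move=> x y; have := orth x y; have := orth y x.
rewrite !rdotBr => /subr0_eq e1 /subr0_eq ->.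
by rewrite (rdotC x) e1 rdotC.
Qed.

End InnerProduct.

(** * C*-algebras *)

Local Notation "x ** y" := (bmul x y) (at level 40, left associativity).

Section BanachAlgebra.
Context {R : realType} {A : banachAlgType R}.
Implicit Types (x y z : A) (a : R[i]).

Lemma bmulDl x y z : (x + y) ** z = x ** z + y ** z.
Proof. exact: (linfD (bmul_linearl z)). Qed.

Lemma bmulDr x y z : x ** (y + z) = x ** y + x ** z.
Proof. exact: (linfD (bmul_linearr x)). Qed.

Lemma bmulZl a x y : (a *: x) ** y = a *: (x ** y).
Proof. exact: (linfZ (bmul_linearl y)). Qed.

Lemma bmulZr a x y : x ** (a *: y) = a *: (x ** y).
Proof. exact: (linfZ (bmul_linearr x)). Qed.

Lemma bmulNl x y : (- x) ** y = - (x ** y).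
Proof. exact: (linfN (bmul_linearl y)). Qed.

Lemma bmulNr x y : x ** (- y) = - (x ** y).
Proof. exact: (linfN (bmul_linearr x)). Qed.

Lemma nrm_bmul x y : nrm (x ** y) <= nrm x * nrm y.
Proof. by rewrite -lecR rmorphM /= -!normE bmul_norm. Qed.

Lemma opalg_generated_ind (P : set A) (G : set A) : opalg_generated G ->
  (forall x, (forall e, 0 < e -> exists2 y, P y & nrm (x - y) < e) -> P x) ->
  subalgebra P -> G `<=` P -> forall x, P x.
Proof.
move=> genG cP sP GP x.
by rewrite (genG P) //; exact: closed_nrm.
Qed.

End BanachAlgebra.

Section CstarAlgebra.
Context {R : realType} {A : cstarAlgType R}.
Implicit Types (x y z : A) (a : R[i]).

Lemma starDZ a x y : star (a *: x + y) = conjc a *: star x + star y.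
Proof. exact: star_linear. Qed.

Lemma starD x y : star (x + y) = star x + star y.
Proof. by have := starDZ 1 x y; rewrite conjc1 !scale1r. Qed.

Lemma star0 : star 0 = 0 :> A.
Proof. by apply: (@addrI _ (star 0)); rewrite -starD !addr0. Qed.

Lemma starZ a x : star (a *: x) = conjc a *: star x.
Proof. by have := starDZ a x 0; rewrite star0 !addr0. Qed.

Lemma starN x : star (- x) = - star x.
Proof. by apply: (@addrI _ (star x)); rewrite -starD !subrr star0. Qed.

Lemma starB x y : star (x - y) = star x - star y.
Proof. by rewrite starD starN. Qed.

Lemma starZr (c : R) x : star (c%:C *: x) = c%:C *: star x.
Proof. by rewrite starZ conjc_real. Qed.

Lemma cstar_nrm x : nrm (star x ** x) = nrm x ^+ 2.
Proof. by apply: complexI; rewrite -normE cstar_identity normE rmorphXn. Qed.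

Lemma nrm_star x : nrm (star x) = nrm x.
Proof.
suff le y : nrm y <= nrm (star y).
  by apply/le_anti; rewrite le andbT -{2}[x]starK le.
have [->|y0] := eqVneq (nrm y) 0; first exact: nrm_ge0.
have yp : 0 < nrm y by rewrite lt_def y0 nrm_ge0.
by rewrite -(ler_pM2r yp) -expr2 -cstar_nrm nrm_bmul.
Qed.

Lemma cstar_nrmr x : nrm (x ** star x) = nrm x ^+ 2.
Proof. by rewrite -{1}[x]starK cstar_nrm nrm_star. Qed.

(* With a = 1 - (1 - z)^2, the element 1 - z is a square root of 1 - a. *)
Lemma quasi_sqrt (a : A) (r : R) : 0 <= r < 1 -> nrm a <= r ^+ 2 ->
  star a = a -> exists z, [/\ star z = z, z + z = a + z ** z & nrm z <= r].
Proof.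
move=> r01 ar sa; have /andP[r0 r1] := r01.
pose F z : A := (2^-1)%:C *: (a + z ** z).
have FB x y : nrm x <= r -> nrm y <= r -> nrm (F x - F y) <= r * nrm (x - y).
  move=> xr yr; rewrite -scalerBr nrmZr ger0_norm ?invr_ge0 //.
  rewrite opprD addrACA subrr add0r.
  have -> : x ** x - y ** y = (x - y) ** x + y ** (x - y).
    by rewrite bmulDl bmulDr bmulNl bmulNr addrA subrK.
  rewrite mulrC ler_pdivrMr // (le_trans (nrmD _ _)) //.
  have h1 := nrm_bmul (x - y) x; have h2 := nrm_bmul y (x - y).
  rewrite (le_trans (lerD h1 h2)) //.
  have := nrm_ge0 (x - y) => d0.
  have := ler_wpM2l d0 xr; have := ler_wpM2r d0 yr.
  by rewrite (mulrC r); lra.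
have [||||z /= zr Fz] := @contraction_fixpoint _ _ F [set z | nrm z <= r] r r01.
- by rewrite /= nrm0.
- move=> z /= zr; rewrite nrmZr ger0_norm ?invr_ge0 //.
  rewrite mulrC ler_pdivrMr // (le_trans (nrmD _ _)) //.
  have zz : nrm (z ** z) <= r ^+ 2.
    by rewrite (le_trans (nrm_bmul _ _)) // expr2 ler_pM // nrm_ge0.
  rewrite (le_trans (lerD ar zz)) //.
  have : r ^+ 2 <= r by rewrite expr2 ler_piMl // ltW.
  by lra.
- move=> z hz; apply/ler_addgt0Pl => e /hz [y /= yr zy].
  rewrite -[z](subrK y) (le_trans (nrmD _ _)) // lerD //; exact: ltW.
- by move=> x y; exact: FB.
have zE : z + z = a + z ** z.
  rewrite -{1 2}Fz /F -scalerDl -rmorphD /=.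
  by rewrite [2^-1 + _](_ : _ = 1) ?scale1r //; field.
exists z; split => //.
(* A second fixed point in the ball, where [F] is strictly contractive; hence [star z = z]. *)
have Fs : F (star z) = star z.
  by rewrite -{2}Fz /F starZr starD sa star_bmul.
have sr : nrm (star z) <= r by rewrite nrm_star.
have := FB _ _ sr zr; rewrite Fs Fz -subr_le0.
rewrite -[X in X - _]mul1r -mulrBl pmulr_rle0 ?subr_gt0 // => n0.
apply/eqP; rewrite -subr_eq0; apply/eqP/nrm0_eq0/eqP.
by rewrite eq_le n0 nrm_ge0.
Qed.

Lemma unit_star (e : A) : is_unit e -> star e = e.
Proof.
move=> ue; have [_ h] := ue (star e).
have : star (star e ** e) = star (star e) by rewrite h.
rewrite star_bmul starK => h2.
by rewrite -{2}h2 (proj2 (ue (star e))).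
Qed.

(** The defect is [d = e - z], with [z] from [quasi_sqrt] for [star x ** x] and radius |x|. *)
Lemma unit_complement (e x : A) : is_unit e -> nrm x < 1 ->
  exists d, star x ** x + star d ** d = e.
Proof.
move=> ue x1; have [|||z [sz zE _]] := @quasi_sqrt (star x ** x) (nrm x).
- by rewrite nrm_ge0 x1.
- by rewrite cstar_nrm.
- by rewrite star_bmul starK.
exists (e - z); rewrite starB (unit_star ue) sz bmulDl bmulNl !bmulDr !bmulNr.
rewrite (proj1 (ue e)) (proj1 (ue z)) (proj2 (ue z)) opprB addrACA -opprD zE.
by rewrite opprD [- _ + _]addrC [e + _ + _]addrA addrK addrCA subrr addr0.
Qed.

(** With [y = x (c + i d a)], written without a unit, the mixed terms of [y ** star y] cancel as in
    |c + i d|^2 = c^2 + d^2, because [a] is self-adjoint. *)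
Lemma twist_nrm (a x : A) (c d : R) : star a = a ->
  nrm (c%:C *: x + ('i * d%:C) *: (x ** a)) ^+ 2 =
  nrm ((c ^+ 2)%:C *: (x ** star x)
       + (d ^+ 2)%:C *: (x ** a ** star (x ** a))).
Proof.
move=> sa; rewrite -cstar_nrmr; congr nrm.
rewrite starD starZr starZ star_bmul sa.
rewrite bmulDl !bmulDr !bmulZl !bmulZr !scalerA.
rewrite -[x ** a ** star x]bmulA addrA.
rewrite -[X in X + _]addrA -scalerDl.
rewrite [X in X *: (x ** (a ** star x))](_ : _ = 0); last first.
  by apply/eqP; rewrite eq_complex /=; apply/andP; split; apply/eqP; ring.
rewrite scale0r addr0; congr (_ *: _ + _ *: _).
  by rewrite -rmorphM -expr2.
by apply/eqP; rewrite eq_complex /=; apply/andP; split; apply/eqP; ring.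
Qed.

Lemma twist_nrm_le (a x : A) (c d : R) : star a = a ->
  nrm (c%:C *: x + ('i * d%:C) *: (x ** a)) ^+ 2 <=
  (c ^+ 2 + d ^+ 2 * nrm a ^+ 2) * nrm x ^+ 2.
Proof.
move=> sa; rewrite twist_nrm // (le_trans (nrmD _ _)) // !nrmZr !ger0_norm
  ?sqr_ge0 //.
rewrite !cstar_nrmr mulrDl lerD // -mulrA ler_wpM2l ?sqr_ge0 // -exprMn.
by rewrite lerXn2r ?nnegrE ?mulr_ge0 ?nrm_ge0 // mulrC nrm_bmul.
Qed.

(** Inverts [1 - i mu a] for every real [mu]. A Neumann series would need [mu a] small; instead the
    damped iteration [x + th (c0 - x (1 - i mu a))] is contractive, by [twist_nrm_le]. *)
Lemma twist_solve (a c0 : A) (mu : R) : star a = a ->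
  exists x, x - ('i * mu%:C) *: (x ** a) = c0.
Proof.
move=> sa; set m := mu ^+ 2 * nrm a ^+ 2.
have m0 : 0 <= m by rewrite mulr_ge0 ?sqr_ge0.
(* Minimises [(1 - th)^2 + th^2 m]; the minimum [m / (1 + m)] is [q^2] below. *)
set th := (1 + m)^-1; have m1 : 0 < 1 + m by rewrite ltr_pwDl.
have th0 : 0 < th by rewrite invr_gt0.
pose L x : A := (1 - th)%:C *: x + ('i * (th * mu)%:C) *: (x ** a).
pose F x : A := L x + th%:C *: c0.
have LB x y : L x - L y = L (x - y).
  rewrite /L bmulDl bmulNl !scalerDr !scalerN opprD addrACA.
  by congr (_ + _).
pose q := Num.sqrt (m / (1 + m)).
have q01 : 0 <= q < 1.
  rewrite sqrtr_ge0 -sqrtr1 ltr_sqrt // ltr_pdivrMr // mul1r.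
  by rewrite ltrDr ltr01.
have Lq x : nrm (L x) <= q * nrm x.
  rewrite -(ler_sqr (nrm_ge0 _)); last first.
    by rewrite nnegrE mulr_ge0 ?nrm_ge0 // sqrtr_ge0.
  rewrite (le_trans (twist_nrm_le _ _ _ sa)) // [(q * _) ^+ 2]exprMn sqr_sqrtr;
    last first.
    by rewrite divr_ge0 // ltW.
  rewrite ler_wpM2r ?sqr_ge0 // exprMn -mulrA -/m le_eqVlt; apply/orP; left.
  by apply/eqP; rewrite /th; field; rewrite gt_eqF.
have [|x _ Fx] := @contraction_fixpoint _ _ F setT q q01 I (fun _ _ => I)
   (fun _ _ => I).
  by move=> x y _ _; rewrite /F opprD addrACA subrr addr0 LB.
exists x.
have : th%:C *: (x - ('i * mu%:C) *: (x ** a)) = th%:C *: c0.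
  move: Fx => /(congr1 (fun y => y - L x)); rewrite /F addrAC subrr add0r => ->.
  rewrite /L opprD addrA -[X in X - _ *: x]scale1r -scalerBl scalerBr scalerA.
  congr (_ *: _ - _ *: _).
    by rewrite -rmorphB /=; congr (_ %:C); ring.
  by apply/eqP; rewrite eq_complex /=; apply/andP; split; apply/eqP; ring.
move=> /(congr1 (fun y => (th^-1)%:C *: y)).
by rewrite !scalerA -rmorphM /= mulVf ?gt_eqF // !scale1r.
Qed.

(** [x (1 - i mu a)] and [x (1 + i mu a)] have the same norm by [twist_nrm]; their sum is [2 x] and
    their difference is, up to sign, [2 i mu x a]. *)
Lemma twist_bound (a x : A) (mu : R) : star a = a ->
  nrm x <= nrm (x - ('i * mu%:C) *: (x ** a)) /\
  `|mu| * nrm (x ** a) <= nrm (x - ('i * mu%:C) *: (x ** a)).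
Proof.
move=> sa; set J := 'i * mu%:C; set c := _ - _; set d := x + J *: (x ** a).
have cd : nrm c = nrm d.
  apply/eqP; rewrite -(eqrXn2 (n := 2)) ?nrm_ge0 //; apply/eqP.
  have -> : c = 1%:C *: x + ('i * (- mu)%:C) *: (x ** a).
    by rewrite scale1r rmorphN mulrN scaleNr.
  have -> : d = 1%:C *: x + ('i * mu%:C) *: (x ** a).
    by rewrite scale1r.
  by rewrite !twist_nrm // sqrrN.
have dbl y : 2 * nrm y = nrm (y + y).
  have -> : y + y = (1 + 1 : R)%:C *: y by rewrite rmorphD scalerDl scale1r.
  by rewrite nrmZr ger0_norm // addr_ge0.
split; rewrite -(ler_pM2l (ltr0n R 2)) /=.
  rewrite dbl [2 * _]mulr_natl mulr2n [X in _ <= _ + X]cd.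
  rewrite [X in nrm X <= _](_ : _ = c + d) ?nrmD //.
  by rewrite /c /d addrACA addNr addr0.
have -> : `|mu| * nrm (x ** a) = nrm (J *: (x ** a)).
  rewrite nrmZ normc_def /=; congr (_ * _).
  by rewrite [X in Num.sqrt X](_ : _ = mu ^+ 2) ?sqrtr_sqr //=; ring.
rewrite dbl [2 * _]mulr_natl mulr2n [X in _ <= X + _]cd.
rewrite [X in nrm X <= _](_ : _ = d - c) ?nrmB //.
by rewrite /c /d opprD opprK addrACA subrr add0r.
Qed.

(** Both sides equal [X (1 + m a^2) star Z]: the self-adjoint resolvent of [a] moves from one factor
    to the other. *)
Lemma resolvent_sym (a x X z Z : A) (m : R) : star a = a ->
  X + m%:C *: (X ** a ** a) = x -> Z + m%:C *: (Z ** a ** a) = z ->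
  X ** star z = x ** star Z.
Proof.
move=> sa <- <-; rewrite starD starZr !star_bmul sa bmulDl bmulDr bmulZl bmulZr.
by rewrite !bmulA.
Qed.

(** Two applications of [twist_solve], as [1 + mu^2 a^2 = (1 + i mu a) (1 - i mu a)]. *)
Lemma double_twist_solve (a c0 : A) (mu : R) : star a = a -> 0 <= mu ->
  exists x, [/\ x + (mu ^+ 2)%:C *: (x ** a ** a) = c0,
    nrm x <= nrm c0 & mu * nrm (x ** a) <= nrm c0].
Proof.
move=> sa mu0; have [y yE] := twist_solve c0 mu sa.
have [x xE] := twist_solve y (- mu) sa.
have [yc _] := twist_bound y mu sa.
have [xy xay] := twist_bound x (- mu) sa.
exists x; split.
- rewrite -yE -xE rmorphN mulrN scaleNr opprK bmulDl bmulZl scalerDr scalerA.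
  rewrite opprD addrA addrK -scaleNr; congr (_ + _ *: _).
  by apply/eqP; rewrite eq_complex /=; apply/andP; split; apply/eqP; ring.
- by rewrite -{1}yE (le_trans xy) // xE.
- by rewrite normrN ger0_norm // in xay; rewrite (le_trans xay) // xE -yE.
Qed.

End CstarAlgebra.

(** For |y| < 1 let [1 - z] be the square root of [1 - star y ** y]; then |h|^2 - |f y h|^2 = |h - f
    z h|^2 >= 0. Writing [h - f z h] makes sense in degenerate representations too. *)
Lemma star_rep_contractive (R : realType) (A : cstarAlgType R)
    (H : hilbertType R) (f : A -> H -> H) x h :
  star_rep f -> nrm (f x h) <= nrm x * nrm h.
Proof.
move=> [[fb fl fm] fs].
have small y : nrm y < 1 -> nrm (f y h) <= nrm h.
  move=> y1; have [] := @quasi_sqrt _ _ (star y ** y) (nrm y).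
  - by rewrite nrm_ge0 y1.
  - by rewrite cstar_nrm.
  - by rewrite star_bmul starK.
  move=> z [sz zE _]; rewrite -(ler_sqr (nrm_ge0 _) (nrm_ge0 _)).
  rewrite -subr_ge0 [X in 0 <= X](_ : _ = nrm (h - f z h) ^+ 2) ?sqr_ge0 //.
  have gram w : nrm (f w h) ^+ 2 = rdot h (f (star w ** w) h).
    by rewrite -rdot_nrm (rdot_adj _ _ (fs w)) fm.
  rewrite nrm2B !gram sz mulr_natl mulr2n -rdotDr -(linfD (fl h)) zE.
  by rewrite (linfD (fl h)) rdotDr; ring.
apply/ler_addgt0Pl => e e0.
(* Rescaling by slightly more than |x| makes the norm strictly less than 1 and costs at most [e]. *)
set t := nrm x + e / (nrm h + 1).
have h1 : 0 < nrm h + 1 by rewrite ltr_wpDl ?nrm_ge0.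
have xt : nrm x < t by rewrite ltrDl divr_gt0.
have t0 : 0 < t by rewrite (le_lt_trans (nrm_ge0 x)).
have := small ((t^-1)%:C *: x).
rewrite (linfZ (fl h)) !nrmZr gtr0_norm ?invr_gt0 // !(mulrC t^-1).
rewrite !ltr_pdivrMr // !ler_pdivrMr // mul1r => /(_ xt) le1.
rewrite (le_trans le1) // mulrC /t mulrDl addrC lerD2r.
by rewrite mulrAC ler_pdivrMr // ler_wpM2l ?ltW // ltrDl.
Qed.

(** * Star-homomorphisms have closed range *)

Section ClosedRange.
Context {R : realType} {C B : cstarAlgType R} {Phi : C -> B}.
Hypothesis Phis : star_hom Phi.

(* The lift is c = c0 (1 + mu^2 (c0^* c0)^2)^-1 for any preimage c0 of b. *)
Lemma approximate_lift c0 : exists2 c, nrm c <= 2 * nrm (Phi c0) &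
  nrm (Phi c0 - Phi c) <= nrm (Phi c0) / 4.
Proof.
have [[lP mP] sP] := Phis.
have [b0|b0] := eqVneq (nrm (Phi c0)) 0.
  by exists 0; rewrite ?b0 ?nrm0 ?mulr0 // (linf0 lP) subr0 b0 mul0r.
set b := Phi c0 in b0 *; set be := nrm b.
have bep : 0 < be by rewrite lt_def b0 nrm_ge0.
(* Balances two bounds: |c|^2 <= 1 / mu = 2 |b|^2 for the lift, and mu^2 |b|^5 = |b| / 4 for the
   error. *)
set mu := (2 * be ^+ 2)^-1.
have mup : 0 < mu by rewrite invr_gt0 mulr_gt0 // exprn_gt0.
set a := star c0 ** c0.
have sa : star a = a by rewrite star_bmul starK.
have [c [cE cc0 _]] := double_twist_solve c0 sa (ltW mup).
have [d [dE dc dac]] := double_twist_solve c sa (ltW mup).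
(* By [resolvent_sym], [c ** star c] is both [d ** star c0] and [c0 ** star d], so its square is
   [d a star d], of norm at most |d a| |d| <= (|c| / mu) |c|. *)
have c4 : nrm c ^+ 2 * nrm c ^+ 2 <= nrm c ^+ 2 / mu.
  have e1 : c ** star c = d ** star c0 by rewrite (resolvent_sym sa dE cE).
  have e2 : c ** star c = c0 ** star d.
    by rewrite -[LHS]starK star_bmul starK e1 star_bmul starK.
  have h := cstar_nrmr (c ** star c).
  rewrite star_bmul starK {1}e1 {1}e2 -bmulA [star c0 ** _]bmulA -/a bmulA in h.
  rewrite cstar_nrmr in h; rewrite -expr2 -h (le_trans (nrm_bmul _ _)) //.
  rewrite nrm_star expr2 mulrAC ler_pM ?nrm_ge0 // ler_pdivlMr // mulrC.
  exact: dac.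
have c2 : nrm c ^+ 2 <= 2 * be ^+ 2.
  have [->|cn] := eqVneq (nrm c) 0.
    by rewrite expr0n mulr_ge0 ?sqr_ge0.
  by move: c4; rewrite ler_pM2l ?exprn_even_gt0 // /mu invrK.
exists c.
  rewrite -(ler_sqr (nrm_ge0 _)) ?nnegrE ?mulr_ge0 ?nrm_ge0 //.
  rewrite (le_trans c2) // exprMn ler_wpM2r ?sqr_ge0 //.
  by rewrite expr2 -natrM ler_nat.
have Pa : star (Phi a) = Phi a by rewrite -sP sa.
have PcE : Phi c + (mu ^+ 2)%:C *: (Phi c ** Phi a ** Phi a) = b.
  by rewrite -!mP -(linfZ lP) -(linfD lP) cE.
(* [Phi c] arises from [b] by the same two resolvents formed in [B], so [twist_bound] gives the
   constant 1. *)
have Pcb : nrm (Phi c) <= be.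
  set J := 'i * mu%:C; set y := Phi c + J *: (Phi c ** Phi a).
  have yb : y - J *: (y ** Phi a) = b.
    rewrite -PcE /y bmulDl bmulZl scalerDr scalerA opprD addrA addrK -scaleNr.
    congr (_ + _ *: _).
    by apply/eqP; rewrite eq_complex /=; apply/andP; split; apply/eqP; ring.
  have [h1 _] := twist_bound y mu Pa;
    have [h2 _] := twist_bound (Phi c) (- mu) Pa.
  rewrite rmorphN mulrN scaleNr opprK in h2.
  by rewrite (le_trans h2) // (le_trans h1) // yb.
rewrite -PcE addrC addKr nrmZr ger0_norm ?sqr_ge0 //.
have Pan : nrm (Phi a) = be ^+ 2 by rewrite mP sP cstar_nrm.
have h : nrm (Phi c ** Phi a ** Phi a) <= be * be ^+ 2 * be ^+ 2.
  rewrite (le_trans (nrm_bmul _ _)) // Pan ler_wpM2r ?sqr_ge0 //.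
  by rewrite (le_trans (nrm_bmul _ _)) // Pan ler_wpM2r ?sqr_ge0.
rewrite (le_trans (ler_wpM2l (sqr_ge0 _) h)) // le_eqVlt /mu.
by apply/orP; left; apply/eqP; field; rewrite b0.
Qed.

Hypothesis Phi1 : forall c, nrm (Phi c) <= nrm c.

(** As in the open mapping theorem, approximate lifts of the successive errors have geometrically
    decreasing norms, and their sum lifts [b]. *)
Lemma star_hom_closed_range b :
  (forall e, 0 < e -> exists2 y, range Phi y & nrm (b - y) < e) ->
  range Phi b.
Proof.
have [[lP mP] sP] := Phis.
pose cl b := forall e, 0 < e -> exists2 y, range Phi y & nrm (b - y) < e.
(* Zero is a default outside the closure of the range; a total choice allows the recursion [E]. *)
have step (e : B) : {c | cl e -> [/\ cl (e - Phi c), nrm c <= 4 * nrm e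
    & nrm (e - Phi c) <= nrm e / 2]}.
  apply: cid; have [ce|] := pselect (cl e); last by exists 0.
  have cle c : cl (e - Phi c).
    move=> r /ce [_ [c1 _ <-] hc1]; exists (Phi (c1 - c));
      first by exists (c1 - c).
    by rewrite (linfB lP) opprB addrA subrK.
  have [e0|e0] := eqVneq (nrm e) 0.
    exists 0 => _; split; first exact: cle.
      by rewrite nrm0 e0 mulr0.
    by rewrite (linf0 lP) subr0 e0 mul0r.
  have ep : 0 < nrm e by rewrite lt_def e0 nrm_ge0.
  (* From |Phi c1| <= 9/8 |e|, [approximate_lift] yields |c| <= 9/4 |e| and a total error of at most
     (1/8 + 9/32) |e| < |e| / 2. *)
  have [|_ [c1 _ <-] hc1] := ce (nrm e / 8); first by rewrite divr_gt0.
  have [c n1 n2] := approximate_lift c1.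
  have n3 : nrm (Phi c1) <= nrm e + nrm e / 8.
    by rewrite -[Phi c1](subrK e) (le_trans (nrmD _ _)) // addrC lerD // nrmC
      ltW.
  exists c => _; split; first exact: cle.
    by lra.
  by have := nrm_trans (Phi c1) e (Phi c); lra.
move=> clb.
pose E := fix E k := if k is k'.+1 then E k' - Phi (sval (step (E k'))) else b.
have clE k : cl (E k) by elim: k => //= k ih; case: (svalP (step (E k)) ih).
have nE k : nrm (E k) <= nrm b * 2^-1 ^+ k.
  elim: k => [|k ih]; first by rewrite expr0 mulr1.
  have /= [_ _ h] := svalP (step (E k)) (clE k).
  by rewrite (le_trans h) // exprSr mulrA ler_wpM2r // invr_ge0.
pose s k := \sum_(i < k) sval (step (E i)).
have PsE k : Phi (s k) = b - E k.
  elim: k => [|k ih] /=; first by rewrite /s big_ord0 (linf0 lP) subrr.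
  by rewrite /s big_ord_recr /= (linfD lP) ih opprB addrA addrAC.
have q01 : 0 <= (2^-1 : R) < 1 by rewrite invr_ge0 invf_lt1 // ltr1n ler0n.
have [||c hc] := @geometric_limit _ _ s (4 * nrm b) 2^-1 _ q01.
- by rewrite mulr_ge0 ?nrm_ge0.
- move=> k; rewrite /s big_ord_recr /= addrAC subrr add0r.
  have /= [_ h _] := svalP (step (E k)) (clE k).
  by rewrite (le_trans h) // -mulrA ler_wpM2l ?ler0n // nE.
exists c => //; apply: nrm_eqP => e e0.
set M := 4 * nrm b / (1 - 2^-1) + nrm b.
have M0 : 0 <= M.
  rewrite addr_ge0 ?nrm_ge0 // divr_ge0 ?mulr_ge0 ?nrm_ge0 //.
  by rewrite subr_ge0 ltW //; case/andP: q01.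
have [k hk] := @small_expr _ 2^-1 M e q01 M0 e0.
rewrite (le_trans _ (hk k _)) // (le_trans (nrm_trans (Phi (s k)) _ _)) //.
rewrite mulrDl lerD // -?(linfB lP) ?(le_trans (Phi1 _)) ?hc //.
by rewrite PsE addrAC subrr add0r nrmN.
Qed.

End ClosedRange.

(** * Operator matrices *)

(** [0 <= L] covers the empty set, whose [sup] is 0 by convention. *)
Lemma sup_le (R : realType) (S : set R) L :
  0 <= L -> (forall x, S x -> x <= L) -> sup S <= L.
Proof.
move=> L0 SL; have [->|/set0P S0] := eqVneq S set0; first by rewrite sup0.
by apply: ge_sup => // x /SL.
Qed.

Lemma sup_ge0 (R : realType) (S : set R) :
  (forall x, S x -> 0 <= x) -> 0 <= sup S.
Proof.
move=> S0; have [[[x Sx] uS]|/sup_out ->//] := pselect (has_sup S).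
by apply: le_trans (ub_le_sup uS Sx); exact: S0.
Qed.

Lemma ler_sqrW (R : realType) (x y : R) : 0 <= y -> x ^+ 2 <= y ^+ 2 -> x <= y.
Proof.
move=> y0; case: (lerP x 0) => [x0 _|x0]; first exact: le_trans x0 y0.
by rewrite ler_sqr ?nnegrE // ltW.
Qed.

Section OperatorMatrices.
Context {R : realType} {H : hilbertType R}.

Definition sqnorm k (h : 'I_k -> H) : R := \sum_i nrm (h i) ^+ 2.

Definition mxact k (a : 'M[H -> H]_k) (h : 'I_k -> H) (i : 'I_k) : H :=
  \sum_j a i j (h j).

Lemma sqnorm_ge0 k (h : 'I_k -> H) : 0 <= sqnorm h.
Proof. by rewrite sumr_ge0 // => i _; rewrite sqr_ge0. Qed.

Lemma nrm_le_sqnorm k (h : 'I_k -> H) i : nrm (h i) <= Num.sqrt (sqnorm h).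
Proof.
apply: ler_sqrW; first exact: sqrtr_ge0.
rewrite sqr_sqrtr ?sqnorm_ge0 // /sqnorm (bigD1 i) //= lerDl.
by rewrite sumr_ge0 // => j _; rewrite sqr_ge0.
Qed.

Lemma nrm_sum I (s : seq I) (P : pred I) (F : I -> H) :
  nrm (\sum_(i <- s | P i) F i) <= \sum_(i <- s | P i) nrm (F i).
Proof.
elim/big_rec2: _ => [|i y x _ xy]; first by rewrite nrm0.
by rewrite (le_trans (nrmD _ _)) // lerD2l.
Qed.

(** A crude bound, there to show that the suprema in [opmx_norm] and [cstar_mxnorm] are taken over
    bounded sets. *)
Lemma sqnorm_mxact k (a : 'M[H -> H]_k) (M : 'M[R]_k) h :
  (forall i j x, nrm (a i j x) <= M i j * nrm x) ->
  sqnorm (mxact a h) <= (\sum_i (\sum_j `|M i j|) ^+ 2) * sqnorm h.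
Proof.
move=> aM; rewrite mulr_suml ler_sum // => i _.
rewrite -[sqnorm h]sqr_sqrtr ?sqnorm_ge0 // -exprMn.
rewrite ler_sqr ?nnegrE ?nrm_ge0 //; last first.
  by rewrite mulr_ge0 ?sqrtr_ge0 // sumr_ge0.
rewrite (le_trans (nrm_sum _ _ _)) // mulr_suml ler_sum // => j _.
rewrite (le_trans (aM _ _ _)) // (le_trans (_ : _ <= `|M i j| * nrm (h j))) //.
  by rewrite ler_wpM2r ?nrm_ge0 // ler_norm.
by rewrite ler_wpM2l // nrm_le_sqnorm.
Qed.

Lemma opmx_le k (a : 'M[H -> H]_k) L : 0 <= L ->
  (forall h, sqnorm (mxact a h) <= L ^+ 2 * sqnorm h) -> opmx_norm a <= L.
Proof.
move=> L0 aL; apply: sup_le => // _ [h /= h1 <-].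
apply: ler_sqrW => //; rewrite sqr_sqrtr; last exact: sqnorm_ge0 (mxact a h).
by rewrite (le_trans (aL h)) // ler_piMr ?sqr_ge0.
Qed.

Lemma opmx_ge0 k (a : 'M[H -> H]_k) : 0 <= opmx_norm a.
Proof. by apply: sup_ge0 => _ [h _ <-]; exact: sqrtr_ge0. Qed.

Lemma mxactZ k (a : 'M[H -> H]_k) (c : R) h :
  (forall i j, linear (a i j)) ->
  mxact a (fun i => c%:C *: h i) = fun i => c%:C *: mxact a h i.
Proof.
move=> la; apply/funext => i; rewrite /mxact scaler_sumr; apply: eq_bigr => j _.
exact: linfZ.
Qed.

Lemma sqnormZ k (c : R) (h : 'I_k -> H) :
  sqnorm (fun i => c%:C *: h i) = c ^+ 2 * sqnorm h.
Proof.
rewrite /sqnorm mulr_sumr; apply: eq_bigr => i _.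
by rewrite nrmZr exprMn real_normK ?num_real.
Qed.

Lemma opmx_bound k (a : 'M[H -> H]_k) h : (forall i j, bounded_op (a i j)) ->
  sqnorm (mxact a h) <= opmx_norm a ^+ 2 * sqnorm h.
Proof.
move=> ba; have la i j : linear (a i j) by case: (ba i j).
pose M := \matrix_(i, j) sval (cid (proj2 (ba i j))).
have aM i j x : nrm (a i j x) <= M i j * nrm x.
  by rewrite mxE; exact: (svalP (cid (proj2 (ba i j)))).
have [h0|h0] := eqVneq (sqnorm h) 0.
  by rewrite h0 mulr0 (le_trans (sqnorm_mxact h aM)) // h0 mulr0.
have hp : 0 < sqnorm h by rewrite lt_def h0 sqnorm_ge0.
set c := (Num.sqrt (sqnorm h))^-1.
have c2 : c ^+ 2 = (sqnorm h)^-1 by rewrite exprVn sqr_sqrtr ?sqnorm_ge0.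
have c1 : sqnorm (fun i => c%:C *: h i) = 1 by rewrite sqnormZ c2 mulVf.
suff : sqnorm (mxact a (fun i => c%:C *: h i)) <= opmx_norm a ^+ 2.
  by rewrite mxactZ // sqnormZ c2 mulrC ler_pdivrMr.
rewrite -[leLHS]sqr_sqrtr ?sqnorm_ge0 // ler_sqr ?nnegrE ?sqrtr_ge0 ?opmx_ge0
  //.
apply: ub_le_sup; last by exists (fun i => c%:C *: h i) => //=;
  rewrite -/(sqnorm _) c1.
set K := \sum_i (\sum_j `|M i j|) ^+ 2.
exists (Num.sqrt K) => _ [g /= g1 <-]; rewrite ler_wsqrtr //.
rewrite (le_trans (sqnorm_mxact g aM)) // ler_piMr //.
by rewrite sumr_ge0 // => i _; rewrite sqr_ge0.
Qed.

Lemma mxact_const (f : H -> H) (h : 'I_1 -> H) i :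
  mxact (const_mx f : 'M_1) h i = f (h i).
Proof. by rewrite /mxact big_ord1 mxE (ord1 i). Qed.

Lemma op_norm_le (f : H -> H) L : 0 <= L ->
  (forall x, nrm (f x) <= L * nrm x) -> op_norm f <= L.
Proof.
move=> L0 fL; apply: opmx_le => // h; rewrite /sqnorm !big_ord1 mxact_const.
by rewrite -exprMn ler_sqr ?nnegrE ?mulr_ge0 ?nrm_ge0.
Qed.

Lemma op_norm_bound (f : H -> H) x : bounded_op f ->
  nrm (f x) <= op_norm f * nrm x.
Proof.
move=> bf; have := @opmx_bound 1 (const_mx f) (fun=> x).
rewrite /sqnorm !big_ord1 mxact_const -exprMn => h; apply: ler_sqrW.
  by rewrite mulr_ge0 ?nrm_ge0 ?opmx_ge0.
by apply: h => i j; rewrite mxE.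
Qed.

End OperatorMatrices.

Section MatrixNorms.
Context {R : realType} {H : hilbertType R}.

Lemma rep_linear (A : banachAlgType R) (f : A -> H -> H) x :
  alg_rep f -> linear (f x).
Proof. by case=> fb _ _; case: (fb x). Qed.

Lemma rep_linearl (A : banachAlgType R) (f : A -> H -> H) h :
  alg_rep f -> linear (f^~ h).
Proof. by case. Qed.

Lemma rep_mx_bounded (A : banachAlgType R) (f : A -> H -> H) k
    (a : 'M[A]_k) i j : alg_rep f -> bounded_op (map_mx f a i j).
Proof. by case=> fb _ _; rewrite mxE. Qed.

Lemma star_rep_cstar_mxnorm (C : cstarAlgType R) (f : C -> H -> H) k
    (c : 'M[C]_k) : star_rep f -> opmx_norm (map_mx f c) <= cstar_mxnorm c.
Proof.
move=> fs; apply: ub_le_sup; last by exists H, f.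
set K := \sum_i (\sum_j `|(map_mx (@nrm R C) c) i j|) ^+ 2.
have K0 : 0 <= K by rewrite sumr_ge0 // => i _; rewrite sqr_ge0.
exists (Num.sqrt K) => _ [G [g [gs ->]]].
apply: opmx_le; rewrite ?sqrtr_ge0 // => h; rewrite sqr_sqrtr //.
by apply: sqnorm_mxact => i j x; rewrite !mxE; exact: star_rep_contractive.
Qed.

Lemma cc_rep_nrm (B : opAlgType R) (f : B -> H -> H) b h : cc_rep f ->
  nrm (f b h) <= nrm b * nrm h.
Proof.
move=> [fr fc]; have bf : bounded_op (f b) by case: fr.
rewrite (le_trans (op_norm_bound _ bf)) // ler_wpM2r ?nrm_ge0 //.
rewrite -mxnorm1 (le_trans _ (fc _ _)) // /op_norm.
by rewrite map_const_mx.
Qed.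

End MatrixNorms.

(** For [x] the sum of the [f i (y i)], |x|^2 is both the sum of |f' i x|^2 and that of
    [rdot (y i) (f' i x)]; hence the sum of |y i - f' i x|^2 is [sqnorm y] - |x|^2. *)
Lemma row_contraction (R : realType) (H : hilbertType R) m
    (f f' : 'I_m -> H -> H) (y : 'I_m -> H) :
  (forall i, is_adjoint (f i) (f' i)) ->
  (forall x, \sum_i f i (f' i x) = x) ->
  nrm (\sum_i f i (y i)) ^+ 2 <= sqnorm y.
Proof.
move=> ff' f1; set x := \sum_i f i (y i).
have x1 : nrm x ^+ 2 = \sum_i nrm (f' i x) ^+ 2.
  rewrite -rdot_nrm -{1}(f1 x) rdot_suml; apply: eq_bigr => i _.
  by rewrite (rdot_adj _ _ (ff' i)) rdot_nrm.
have x2 : nrm x ^+ 2 = \sum_i rdot (y i) (f' i x).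
  rewrite -rdot_nrm {1}/x rdot_suml; apply: eq_bigr => i _.
  exact: rdot_adj.
have : 2 * nrm x ^+ 2 <= sqnorm y + nrm x ^+ 2.
  rewrite {1}x2 x1 mulr_sumr -big_split ler_sum //= => i _.
  by rewrite -subr_ge0 addrAC -nrm2B sqr_ge0.
by lra.
Qed.

(** * Direct sums and subspaces of Hilbert spaces *)

(** A separate type, as the product itself carries the maximum norm, which comes from no inner
    product. *)
Definition dsum (R : realType) (K1 K2 : hilbertType R) : Type := (K1 * K2)%type.

Section DirectSum.
Context {R : realType} {K1 K2 : hilbertType R}.
Local Notation D := (dsum K1 K2).

HB.instance Definition _ := GRing.Lmodule.copy D (K1 * K2)%type.

Implicit Types x y : D.

Definition dsum_nrm x : R := Num.sqrt (nrm x.1 ^+ 2 + nrm x.2 ^+ 2).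

Lemma dsum_nrm2 x : dsum_nrm x ^+ 2 = nrm x.1 ^+ 2 + nrm x.2 ^+ 2.
Proof. by rewrite sqr_sqrtr // addr_ge0 ?sqr_ge0. Qed.

Lemma dsum_nrmD x y : dsum_nrm (x + y) <= dsum_nrm x + dsum_nrm y.
Proof.
have [x0 y0] : 0 <= dsum_nrm x /\ 0 <= dsum_nrm y by rewrite !sqrtr_ge0.
apply: ler_sqrW; first exact: addr_ge0.
have h1 : nrm (x + y).1 ^+ 2 <= (nrm x.1 + nrm y.1) ^+ 2.
  by rewrite ler_sqr ?nnegrE ?addr_ge0 ?nrm_ge0 // nrmD.
have h2 : nrm (x + y).2 ^+ 2 <= (nrm x.2 + nrm y.2) ^+ 2.
  by rewrite ler_sqr ?nnegrE ?addr_ge0 ?nrm_ge0 // nrmD.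
have cs : nrm x.1 * nrm y.1 + nrm x.2 * nrm y.2 <= dsum_nrm x * dsum_nrm y.
  apply: ler_sqrW; first exact: mulr_ge0.
  rewrite exprMn !dsum_nrm2 -subr_ge0.
  rewrite [X in 0 <= X](_ : _ = (nrm x.1 * nrm y.2 - nrm x.2 * nrm y.1) ^+ 2).
    exact: sqr_ge0.
  by ring.
rewrite dsum_nrm2 (le_trans (lerD h1 h2)) // !sqrrD !dsum_nrm2.
move: (nrm x.1) (nrm x.2) (nrm y.1) (nrm y.2) cs => a b c d cs.
by move: (dsum_nrm x) (dsum_nrm y) cs => e f; lra.
Qed.

Lemma dsum_nrmZ (l : R[i]) x : (dsum_nrm (l *: x))%:C = `|l| * (dsum_nrm x)%:C.
Proof.
have -> : `|l| = (complex.Re `|l|)%:C by rewrite RRe_real // ger0_real.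
rewrite -rmorphM /=; congr _%:C.
have l0 : 0 <= complex.Re `|l| by rewrite -ler0c RRe_real // ger0_real.
apply/eqP; rewrite -(eqrXn2 (n := 2)) ?mulr_ge0 ?sqrtr_ge0 //.
by rewrite exprMn !dsum_nrm2 !nrmZ !exprMn mulrDr.
Qed.

Lemma dsum_nrm0 x : (dsum_nrm x)%:C = 0 -> x = 0.
Proof.
move=> /complexI /(congr1 (fun r => r ^+ 2)); rewrite dsum_nrm2 expr0n /=.
move/eqP; rewrite paddr_eq0 ?sqr_ge0 // !sqrf_eq0 => /andP[/eqP x1 /eqP x2].
by rewrite [x]surjective_pairing (nrm0_eq0 x1) (nrm0_eq0 x2).
Qed.

Lemma dsum_norm_triangle x y :
  (dsum_nrm (x + y))%:C <= (dsum_nrm x)%:C + (dsum_nrm y)%:C.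
Proof. by rewrite -rmorphD lecR dsum_nrmD. Qed.

HB.instance Definition _ := Lmodule_isNormed.Build R[i] D
  dsum_norm_triangle dsum_nrmZ dsum_nrm0.

Lemma dsum_nrmE x : nrm x = dsum_nrm x.
Proof. by []. Qed.

Lemma dsum_complete (F : set_system D) : ProperFilter F -> cauchy F -> cvg F.
Proof.
move=> FF cF.
have cF1 : cauchy (fst @ F).
  apply: cauchy_exP => e e0.
  have [x Fx] := (cauchyP F).1 cF e e0; exists x.1.
  suff : F [set y : D | ball x.1 e y.1] by [].
  apply: filterS Fx => y.
  rewrite -!ball_normE /ball_ /= !normE.
  move=> h; apply: le_lt_trans h; rewrite lecR; apply: ler_sqrW; first exact:
    nrm_ge0.
  by rewrite [X in _ <= X]dsum_nrm2 lerDl sqr_ge0.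
have cF2 : cauchy (snd @ F).
  apply: cauchy_exP => e e0.
  have [x Fx] := (cauchyP F).1 cF e e0; exists x.2.
  suff : F [set y : D | ball x.2 e y.2] by [].
  apply: filterS Fx => y.
  rewrite -!ball_normE /ball_ /= !normE.
  move=> h; apply: le_lt_trans h; rewrite lecR; apply: ler_sqrW; first exact:
    nrm_ge0.
  by rewrite [X in _ <= X]dsum_nrm2 lerDr sqr_ge0.
have /cauchy_cvgP /cvg_ex [l1 h1] := cF1.
have /cauchy_cvgP /cvg_ex [l2 h2] := cF2.
apply/cvg_ex; exists ((l1, l2) : D); apply/cvgrPdist_le => e e0.
have e2 : 0 < e / 2 by rewrite divr_gt0.
have /cvgrPdist_le/(_ _ e2) n1 := h1.
have /cvgrPdist_le/(_ _ e2) n2 := h2.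
near=> x.
have x1 : `|l1 - x.1| <= e / 2 by near: x; exact: n1.
have x2 : `|l2 - x.2| <= e / 2 by near: x; exact: n2.
apply: le_trans (_ : `|l1 - x.1| + `|l2 - x.2| <= _); last first.
  by rewrite [e](splitr e) lerD.
rewrite !normE -rmorphD lecR; apply: ler_sqrW;
  first by rewrite addr_ge0 ?nrm_ge0.
rewrite [X in X <= _]dsum_nrm2 /= sqrrD -addrA lerD2l lerDr.
by rewrite mulrn_wge0 // mulr_ge0 ?nrm_ge0.
Unshelve. all: by end_near. Qed.

HB.instance Definition _ := Uniform_isComplete.Build D dsum_complete.

Definition dsum_dot x y : R[i] := dot x.1 y.1 + dot x.2 y.2.

Lemma dsum_dot_linear z (a : R[i]) x y :
  dsum_dot (a *: x + y) z = a * dsum_dot x z + dsum_dot y z.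
Proof. by rewrite /dsum_dot /= !dot_linear mulrDr addrACA. Qed.

Lemma dsum_dot_conj x y : dsum_dot y x = conjc (dsum_dot x y).
Proof. by rewrite /dsum_dot rmorphD /= -!dot_conj. Qed.

Lemma dsum_dot_norm x : dsum_dot x x = `|x| ^+ 2.
Proof.
by rewrite normE -rmorphXn [nrm x ^+ 2]dsum_nrm2 /dsum_dot !dot_norm !normE
  -!rmorphXn -rmorphD.
Qed.

HB.instance Definition _ := CompleteNormedModule_isHilbert.Build R D
  dsum_dot_linear dsum_dot_conj dsum_dot_norm.

End DirectSum.

(** A closed subspace is encoded as the fixed space of a linear contraction: continuity makes it
    complete. *)
Record contraction_op (R : realType) (H : hilbertType R) := ContractionOp {
  contr_fun :> H -> H;
  contr_linear : linear contr_fun;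
  contr_nrm : forall x, nrm (contr_fun x) <= nrm x }.

Definition fixpred (R : realType) (H : hilbertType R) (P : contraction_op H) :
  {pred H} := fun x => P x == x.

Section FixedSpace.
Context {R : realType} {H : hilbertType R} (P : contraction_op H).

Lemma fixpred_submod : GRing.submod_closed (fixpred P).
Proof.
split; first by rewrite unfold_in (linf0 (contr_linear P)).
move=> a x y; rewrite !unfold_in => /eqP xE /eqP yE.
by rewrite contr_linear xE yE.
Qed.

HB.instance Definition _ :=
  GRing.isSubmodClosed.Build R[i] H (fixpred P) fixpred_submod.

Record fixspace := FixSpace {fixval :> H; fixvalP : fixval \in fixpred P}.

HB.instance Definition _ := [isSub for fixval].
HB.instance Definition _ := [Choice of fixspace by <:].
HB.instance Definition _ := [SubChoice_isSubLmodule of fixspace by <:].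

Implicit Types x y : fixspace.

Lemma fixvalD x y : fixval (x + y) = fixval x + fixval y.
Proof. exact: (raddfD (val : fixspace -> H)). Qed.

Lemma fixvalZ a x : fixval (a *: x) = a *: fixval x.
Proof. exact: (linearZZ (val : fixspace -> H)). Qed.

Lemma fixval0 : fixval 0 = 0.
Proof. exact: (raddf0 (val : fixspace -> H)). Qed.

Lemma fixval_linear : linear fixval.
Proof. by move=> a x y; rewrite fixvalD fixvalZ. Qed.

Lemma fixspace_normD x y : `|fixval (x + y)| <= `|fixval x| + `|fixval y|.
Proof. by rewrite fixvalD ler_normD. Qed.

Lemma fixspace_normZ (l : R[i]) x : `|fixval (l *: x)| = `|l| * `|fixval x|.
Proof. by rewrite fixvalZ normrZ. Qed.

Lemma fixspace_norm0 x : `|fixval x| = 0 -> x = 0.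
Proof. by move/normr0_eq0 => x0; apply: val_inj; rewrite [RHS]fixval0. Qed.

HB.instance Definition _ := Lmodule_isNormed.Build R[i] fixspace
  fixspace_normD fixspace_normZ fixspace_norm0.

Lemma nrm_fixval x : nrm (fixval x) = nrm x.
Proof. by []. Qed.

Lemma fixspace_complete (F : set_system fixspace) :
  ProperFilter F -> cauchy F -> cvg F.
Proof.
move=> FF cF.
have cF1 : cauchy (fixval @ F).
  apply: cauchy_exP => e e0.
  have [x Fx] := (cauchyP F).1 cF e e0; exists (fixval x).
  suff : F [set y : fixspace | ball (fixval x) e (fixval y)] by [].
  apply: filterS Fx => y; rewrite -!ball_normE /ball_ /= !normE -nrm_fixval.
  by rewrite (linfB fixval_linear).
have /cauchy_cvgP /cvg_ex [l hl] := cF1.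
have lP : l \in fixpred P.
  rewrite unfold_in; apply/eqP; apply: nrm_eqP => e e0.
  have e2 : 0 < (e / 2)%:C by rewrite ltcR divr_gt0.
  have /cvgrPdist_le/(_ _ e2) n1 := hl.
  have n2 : F [set x : fixspace | `|l - fixval x| <= (e / 2)%:C] by exact: n1.
  have [x /=] := filter_ex n2; rewrite normE lecR => lx.
  rewrite (le_trans (nrm_trans (fixval x) _ _)) // (splitr e) lerD //.
    have {1}<- : P (fixval x) = fixval x.
      by have := fixvalP x; rewrite unfold_in => /eqP.
    by rewrite -(linfB (contr_linear P)) (le_trans (contr_nrm P _)).
  by rewrite nrmC.
apply/cvg_ex; exists (FixSpace lP); apply/cvgrPdist_le => e e0.
have /cvgrPdist_le/(_ _ e0) n1 := hl.
have n2 : F [set x : fixspace | `|l - fixval x| <= e] by exact: n1.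
apply: filterS n2 => x /=; rewrite !normE -nrm_fixval.
by rewrite (linfB fixval_linear).
Qed.

HB.instance Definition _ := Uniform_isComplete.Build fixspace fixspace_complete.

Definition fixspace_dot x y : R[i] := dot (fixval x) (fixval y).

Lemma fixspace_dot_linear z (a : R[i]) x y :
  fixspace_dot (a *: x + y) z = a * fixspace_dot x z + fixspace_dot y z.
Proof. by rewrite /fixspace_dot fixval_linear dot_linear. Qed.

Lemma fixspace_dot_conj x y : fixspace_dot y x = conjc (fixspace_dot x y).
Proof. by rewrite /fixspace_dot -dot_conj. Qed.

Lemma fixspace_dot_norm x : fixspace_dot x x = `|x| ^+ 2.
Proof. by rewrite /fixspace_dot dot_norm. Qed.

HB.instance Definition _ := CompleteNormedModule_isHilbert.Build R fixspace
  fixspace_dot_linear fixspace_dot_conj fixspace_dot_norm.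

End FixedSpace.

(** * Approximation in convex cones *)

(* If the separating functional lam satisfies lam <= gamma * N on the cone up to
   the slack eta of a near-minimiser of the distance, then the distance to tau
   is O(sqrt eta). *)
Lemma cone_approx (R : realType) m (S : ('I_m -> R) -> R -> Prop) (M N0 : R)
    (tau : 'I_m -> R) : 0 <= M -> 0 <= N0 ->
  S (fun=> 0) 0 ->
  (forall u v a b, S u a -> S v b -> S (fun p => u p + v p) (a + b)) ->
  (forall c v b, 0 <= c -> S v b -> S (fun p => c * v p) (c * b)) ->
  (forall v b, S v b -> 0 <= b /\ \sum_p v p ^+ 2 <= M * b ^+ 2) ->
  (forall lam gam, 0 <= gam ->
    (forall v b, S v b -> \sum_p lam p * v p <= gam * b) ->
    \sum_p lam p * tau p <= gam * N0) ->
  forall e, 0 < e -> exists v b, S v b /\ forall p, `|tau p - v p| <= e.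
Proof.
move=> M0 N00 S0 SD SZ SM Sdual e e0.
pose ip (u v : 'I_m -> R) := \sum_p u p * v p.
have ipss u : 0 <= ip u u by rewrite sumr_ge0 // => p _; rewrite -expr2 sqr_ge0.
have ipC u v : ip u v = ip v u by apply: eq_bigr => p _; rewrite mulrC.
have ipDr u v w : ip u (fun p => v p + w p) = ip u v + ip u w.
  by rewrite /ip -big_split; apply: eq_bigr => p _; rewrite mulrDr.
have ipZr u c v : ip u (fun p => c * v p) = c * ip u v.
  by rewrite /ip mulr_sumr; apply: eq_bigr => p _; rewrite mulrCA.
have ipDl u v w : ip (fun p => v p + w p) u = ip v u + ip w u.
  by rewrite ipC ipDr !(ipC u).
have ipZl u c v : ip (fun p => c * v p) u = c * ip v u by rewrite ipC ipZr ipC.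
have ipsq u c v : ip (fun p => u p + c * v p) (fun p => u p + c * v p) =
    ip u u + 2 * c * ip u v + c ^+ 2 * ip v v.
  by rewrite ipDl !ipDr !ipZl !ipZr (ipC v u); ring.
pose dist v := ip (fun p => tau p - v p) (fun p => tau p - v p).
pose D := [set dist v | v in [set v | exists b, S v b]].
have [[v [b [Sv ve]]]|far] := pselect (exists v b, S v b /\ dist v <= e ^+ 2).
  exists v, b; split => // p; apply: ler_sqrW; first exact: ltW.
  rewrite real_normK ?num_real // (le_trans _ ve) // /dist /ip (bigD1 p) //=.
  by rewrite -expr2 lerDl sumr_ge0 // => k _; rewrite -expr2 sqr_ge0.
exfalso.
have Dlb : has_lbound D by exists 0 => _ [v _ <-]; exact: ipss.
have D0 : D !=set0 by exists (dist (fun=> 0)), (fun=> 0) => //; exists 0.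
set d := inf D.
have dmin v b : S v b -> d <= dist v.
  by move=> Sv; apply: inf_lbound => //; exists v => //; exists b.
have dp : 0 < d.
  rewrite (lt_le_trans (_ : 0 < e ^+ 2)) ?exprn_gt0 //.
  apply: lb_le_inf => // _ [v [b Sv] <-]; rewrite leNgt; apply/negP => ve.
  by apply: far; exists v, b; split => //; exact: ltW.
have dtau : d <= ip tau tau.
  rewrite (le_trans (dmin _ _ S0)) // le_eqVlt; apply/orP; left; apply/eqP.
  by apply: eq_bigr => p _; rewrite subr0.
(* [K] bounds |v|^2 <= 2 |tau|^2 + 2 |tau - v|^2 for the near-minimiser [v], as |tau - v|^2 < d +
   w^2 <= |tau|^2 + 1. [L] collects the error terms of [ltau] and [low]. *)
set K := 4 * ip tau tau + 2.
set L := (1 + M) * N0 + (1 + K).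
have K0 : 0 <= K by rewrite addr_ge0 // mulr_ge0.
have Lp : 0 < L by rewrite ltr_wpDl ?mulr_ge0 ?addr_ge0 // ltr_pwDl.
(* Chosen for [w <= 1] and [w * L < d]; the final estimate [d <= w * L / 2] is then absurd. *)
set w := d / (d + L).
have dL : 0 < d + L by rewrite addr_gt0.
have wp : 0 < w by rewrite divr_gt0.
have w1 : w <= 1 by rewrite ler_pdivrMr // mul1r lerDl ltW.
have wL : w * L < d.
  by rewrite mulrAC ltr_pdivrMr // ltr_pM2l // ltrDr.
(* The cone is not known to be closed, so the distance need not be attained. *)
have [_ [v [b Sv] <-] vd] : exists2 x, D x & x < d + w ^+ 2.
  by apply: inf_adherent; rewrite ?exprn_gt0.
pose lam p := tau p - v p.
have lamE : dist v = ip lam lam by [].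
have up u a : S u a -> ip lam u <= w * ((1 + M) / 2) * a.
  move=> Su; have [a0 uM] := SM _ _ Su.
  have uu : ip u u <= M * a ^+ 2.
    by rewrite (le_trans _ uM) // ler_sum // => p _; rewrite expr2.
  (* Near-minimality tested on [v + th u]; with [th = w / a] both terms on the right become
     multiples of [w^2]. *)
  have quad th : 0 <= th ->
    2 * th * ip lam u <= w ^+ 2 + th ^+ 2 * (M * a ^+ 2).
    move=> th0; have := dmin _ _ (SD _ _ _ _ Sv (SZ _ _ _ th0 Su)).
    have -> : dist (fun p => v p + th * u p) =
        ip (fun p => lam p + - th * u p) (fun p => lam p + - th * u p).
      by apply: eq_bigr => p _; rewrite /lam; ring.
    rewrite ipsq -lamE; have := ler_wpM2l (sqr_ge0 th) uu.
    by move: vd; lra.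
  have [a00|an0] := eqVneq a 0.
    have uu0 : ip u u = 0.
      by apply/eqP; rewrite eq_le ipss andbT (le_trans uu) // a00 expr0n mulr0.
    have u0 p : u p = 0.
      apply/eqP; rewrite -sqrf_eq0 expr2; apply/eqP.
      move/eqP: uu0; rewrite /ip psumr_eq0 => [|k _]; last first.
        by rewrite -expr2 sqr_ge0.
      by move/allP/(_ p); rewrite mem_index_enum => /(_ isT) /eqP.
    by rewrite a00 mulr0 /ip big1 // => p _; rewrite u0 mulr0.
  have ap : 0 < a by rewrite lt_def an0.
  have := quad (w / a) (divr_ge0 (ltW wp) (ltW ap)).
  have -> : w ^+ 2 + (w / a) ^+ 2 * (M * a ^+ 2) = w ^+ 2 * (1 + M) by field.
  have -> : 2 * (w / a) * ip lam u = (2 * w / a) * ip lam u by ring.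
  have c0 : 0 < 2 * w / a by rewrite divr_gt0 // mulr_gt0.
  move=> h; rewrite -(ler_pM2l c0); apply: le_trans h _.
  rewrite le_eqVlt; apply/orP; left; apply/eqP; field.
  exact: an0.
have ltau : ip lam tau <= w * ((1 + M) / 2) * N0.
  apply: Sdual => // ; rewrite mulr_ge0 ?(ltW wp) // divr_ge0 // addr_ge0 //.
(* Near-minimality tested towards the vertex, on [(1 - w) v]: [lam] is only nearly orthogonal to
   [v]. *)
have low : - (2 * ip lam v) <= w * (1 + ip v v).
  have w1' : 0 <= 1 - w by rewrite subr_ge0.
  have := dmin _ _ (SZ _ _ _ w1' Sv).
  have -> : dist (fun p => (1 - w) * v p) =
      ip (fun p => lam p + w * v p) (fun p => lam p + w * v p).
    by apply: eq_bigr => p _; rewrite /lam; ring.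
  rewrite ipsq -lamE => h; rewrite -(ler_pM2l wp).
  by move: vd; lra.
have vK : ip v v <= K.
  have par : 0 <= ip (fun p => tau p + 1 * lam p) (fun p => tau p + 1 * lam p).
    exact: ipss.
  have vE : ip v v = ip (fun p => tau p + - 1 * lam p) (fun p =>
    tau p + - 1 * lam p).
    by apply: eq_bigr => p _; rewrite /lam; ring.
  have w2 : w ^+ 2 <= 1 by rewrite expr_le1 // ltW.
  by move: par vd; rewrite ipsq vE ipsq lamE /K; lra.
have dE : dist v = ip lam tau - ip lam v.
  rewrite lamE -[X in _ = _ - X]mul1r -mulNr -ipZr -ipDr.
  by apply: eq_bigr => p _; rewrite /lam; ring.
have dv := dmin _ _ Sv.
have h2 := ler_wpM2l (ltW wp) vK.
have h3 : 0 <= w * ((1 + M) * N0).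
  by rewrite mulr_ge0 ?(ltW wp) // mulr_ge0 // addr_ge0.
have h4 : 0 <= w * (1 + K) by rewrite mulr_ge0 ?(ltW wp) // addr_ge0.
by move: ltau low dE dv h2 h3 h4 wL; rewrite /L; lra.
Qed.

(** * Constructions of representations *)

(** Extension by continuity for a relation: points with images that are [2^-k] close to [x] have
    Cauchy images, since [rel] is contractive. *)
Lemma closed_graph_domain (R : realType) (X : normedModType R[i])
    (Y : completeNormedModType R[i]) (rel : X -> Y -> Prop) x :
  (forall x y x' y', rel x y -> rel x' y' -> nrm (y - y') <= nrm (x - x')) ->
  (forall x y, (forall e, 0 < e -> exists x' y',
     [/\ rel x' y', nrm (x - x') < e & nrm (y - y') < e]) -> rel x y) ->
  (forall e, 0 < e -> exists2 x', (exists y, rel x' y) & nrm (x - x') < e) ->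
  exists y, rel x y.
Proof.
move=> relB relC clx.
have e2 k : 0 < (2^-1 : R) ^+ k by rewrite exprn_gt0 // invr_gt0.
have /choice [u hu] : forall k, exists p : X * Y,
    rel p.1 p.2 /\ nrm (x - p.1) < 2^-1 ^+ k.
  by move=> k; have [x' [y xy] xx'] := clx _ (e2 k); exists (x', y).
have q01 : 0 <= (2^-1 : R) < 1 by rewrite invr_ge0 invf_lt1 // ltr1n ler0n.
have [||y hy] := @geometric_limit _ _ (fun k => (u k).2) 2 2^-1 _ q01;
  first by [].
  move=> k; have [r1 n1] := hu k; have [r2 n2] := hu k.+1.
  rewrite (le_trans (relB _ _ _ _ r2 r1)) // (le_trans (nrm_trans x _ _)) //.
  rewrite nrmC; have : 2^-1 ^+ k.+1 <= (2^-1 : R) ^+ k.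
    by rewrite exprS ler_piMl ?ltW //; case/andP: q01.
  by move: n1 n2; lra.
exists y; apply: relC => e e0.
have [||k hk] := @small_expr _ 2^-1 (2 / (1 - 2^-1) + 1) (e / 2) q01.
- rewrite addr_ge0 // divr_ge0 // subr_ge0 ltW //; by case/andP: q01.
- by rewrite divr_gt0.
have [r1 n1] := hu k; exists (u k).1, (u k).2.
have e2e : e / 2 < e by rewrite ltr_pdivrMr // ltr_pMr // ltr1n.
have K0 : 0 <= 2 / (1 - 2^-1) * (2^-1 : R) ^+ k.
  rewrite mulr_ge0 ?ltW // divr_gt0 // subr_gt0; by case/andP: q01.
have := hk k (leqnn k); have := hy k; rewrite mulrDl mul1r.
have := ltW (e2 k) => a0 a1 a2.
by split => //; lra.
Qed.

Section DirectSumRep.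
Context {R : realType} {A : cstarAlgType R} {K1 K2 : hilbertType R}.
Variables (f1 : A -> K1 -> K1) (f2 : A -> K2 -> K2).

Definition dsum_rep (a : A) (x : dsum K1 K2) : dsum K1 K2 :=
  (f1 a x.1, f2 a x.2).

Lemma dsum_rep_star_rep : star_rep f1 -> star_rep f2 -> star_rep dsum_rep.
Proof.
move=> s1 s2; have [[b1 l1 m1] a1] := s1; have [[b2 l2 m2] a2] := s2.
split; first split.
- move=> a; split.
    move=> c x y; have [lf1 _] := b1 a; have [lf2 _] := b2 a.
    by rewrite /dsum_rep /= lf1 lf2.
  exists (nrm a) => x; rewrite !dsum_nrmE; apply: ler_sqrW.
    by rewrite mulr_ge0 ?nrm_ge0 ?sqrtr_ge0.
  rewrite exprMn !dsum_nrm2 /= mulrDr -!exprMn.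
  by rewrite lerD // ler_sqr ?nnegrE ?mulr_ge0 ?nrm_ge0 // star_rep_contractive.
- by move=> h c x y; rewrite /dsum_rep l1 l2.
- by move=> x y h; rewrite /dsum_rep m1 m2.
- by move=> x h k; rewrite /dot /= /dsum_dot /= a1 a2.
Qed.

End DirectSumRep.

Lemma unit_rep_idempotent (R : realType) (A : cstarAlgType R)
    (H : hilbertType R) (f : A -> H -> H) e : is_unit e -> star_rep f ->
  forall x h, f e (f x h) = f x h /\ f x (f e h) = f x h.
Proof. by move=> ue [[_ _ fm] _] x h; rewrite -!fm; have [-> ->] := ue x. Qed.

Lemma unit_nrm (R : realType) (A : cstarAlgType R) (e : A) :
  is_unit e -> nrm e <= 1.
Proof.
move=> ue; have := cstar_nrm e; rewrite (unit_star ue) (proj1 (ue e)) => h.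
have [->|e0] := eqVneq (nrm e) 0; first by [].
have ep : 0 < nrm e by rewrite lt_def e0 nrm_ge0.
by rewrite -(ler_pM2l ep) -expr2 -h mulr1.
Qed.

Section NondegeneratePart.
Context {R : realType} {A : cstarAlgType R} {H : hilbertType R}.
Context {f : A -> H -> H} {e : A} (ue : is_unit e) (fs : star_rep f).

Lemma unit_rep_contractive h : nrm (f e h) <= nrm h.
Proof.
by rewrite (le_trans (star_rep_contractive _ _ fs)) // ler_piMl ?nrm_ge0 //
  unit_nrm.
Qed.

Definition unit_proj := ContractionOp (rep_linear e fs.1) unit_rep_contractive.

Lemma unit_proj_fix x h : f x h \in fixpred unit_proj.
Proof.
by rewrite unfold_in; apply/eqP; case: (unit_rep_idempotent ue fs x h).
Qed.

Definition nondeg_rep (x : A) (h : fixspace unit_proj) : fixspace unit_proj :=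
  FixSpace (unit_proj_fix x h).

Lemma nondeg_rep_star_rep : star_rep nondeg_rep.
Proof.
have [[b l m] a] := fs; split; first split.
- move=> x; split.
    move=> c h k; apply: val_inj => /=.
    by rewrite (rep_linear x fs.1).
  exists (nrm x) => h; rewrite -!nrm_fixval; exact: star_rep_contractive.
- by move=> h c x y; apply: val_inj => /=; rewrite l.
- by move=> x y h; apply: val_inj; rewrite /= m.
- by move=> x h k; exact: a.
Qed.

Lemma nondeg_rep_unit h : nondeg_rep e h = h.
Proof.
by apply: val_inj => /=; have := fixvalP h; rewrite unfold_in => /eqP.
Qed.

(** [f x h = f x (f e h)], so moving every vector into the range of the contraction [f e] changes no
    value and increases no norm. *)
Lemma opmx_nondeg_rep k (c : 'M[A]_k) :
  opmx_norm (map_mx f c) <= opmx_norm (map_mx nondeg_rep c).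
Proof.
have nr := nondeg_rep_star_rep.
apply: opmx_le; first exact: opmx_ge0.
move=> h; pose h' i := FixSpace (unit_proj_fix e (h i)).
have -> : sqnorm (mxact (map_mx f c) h) = sqnorm (mxact (map_mx nondeg_rep c)
  h').
  apply: eq_bigr => i _; rewrite -[in RHS]nrm_fixval; congr (nrm _ ^+ 2).
  rewrite /mxact (linf_sum (@fixval_linear _ _ _)); apply: eq_bigr => j _.
  by rewrite !mxE /=; case: (unit_rep_idempotent ue fs (c i j) (h j)).
have bd i j : bounded_op (map_mx nondeg_rep c i j).
  exact: rep_mx_bounded nr.1.
rewrite (le_trans (opmx_bound _ bd)) // ler_wpM2l ?sqr_ge0 //.
rewrite ler_sum // => i _; rewrite -nrm_fixval ler_sqr ?nnegrE ?nrm_ge0 //.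
exact: unit_rep_contractive.
Qed.

End NondegeneratePart.

Arguments nondeg_rep {R A H f e} ue fs x h.

(** * The embedding of the tensor algebra *)

Section CovariantReps.
Context {R : realType} {A : cstarAlgType R} {one : A} {alpha : A -> A} {n :
  nat}.
Context {TA : opAlgType R} {iota : A -> TA} {t : 'I_n -> TA}.
Context {B : cstarAlgType R} {j : A -> B} {s : 'I_n -> B}.
Hypothesis hone : is_unit one.
Hypothesis halpha1 : alpha one = one.
Hypothesis hTA : tensor_crossed_product one alpha iota t.
Hypothesis hB : stacey_crossed_product one alpha j s.

Definition covrep (H : hilbertType R) (g : B -> H -> H) : Prop :=
  star_rep g /\ covariant_pair one alpha (g \o j) (g \o s).

(** One covariant pair seen through both universal properties; agreement is asked on generators
    only. *)
Definition matching (H : hilbertType R) (f : TA -> H -> H) (g : B -> H -> H)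
    : Prop :=
  [/\ cc_rep f, covrep g, forall x, f (iota x) = g (j x)
    & forall i, f (t i) = g (s i)].

Lemma covrep_matching (H : hilbertType R) (g : B -> H -> H) :
  covrep g -> exists f, matching f g.
Proof.
move=> [gs gc]; have [_ hT _] := hTA; have [f [fc fi ft]] := hT _ _ _ gc.
by exists f.
Qed.

Lemma matching_exists (H : hilbertType R) (f : TA -> H -> H) : cc_rep f ->
  covariant_pair one alpha (f \o iota) (f \o t) -> exists g, matching f g.
Proof.
move=> fc cf; have [_ hS _] := hB; have [g [gs gj gS]] := hS _ _ _ cf.
exists g; split => //; split => //.
by have -> : g \o j = f \o iota; [exact/funext|have -> : g \o s = f \o t;
  [exact/funext|]].
Qed.

Lemma stacey_nrm_le b L : 0 <= L ->
  (forall (H : hilbertType R) (g : B -> H -> H), covrep g ->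
    forall h, nrm (g b h) <= L * nrm h) -> nrm b <= L.
Proof.
move=> L0 bL; have [_ _ ->] := hB; apply: sup_le => // _ [H [g [gs gc ->]]].
by apply: op_norm_le => // h; exact: bL.
Qed.

(** The norm of [B] is a supremum over covariant representations, so these separate points;
    identities in [B] are checked there. *)
Lemma stacey_ext b b' :
  (forall (H : hilbertType R) (g : B -> H -> H), covrep g ->
    forall h, g b h = g b' h) -> b = b'.
Proof.
move=> bb; apply/eqP; rewrite -subr_eq0; apply/eqP/nrm0_eq0/eqP.
rewrite eq_le nrm_ge0 andbT; apply: stacey_nrm_le => // H g gc h.
by have [[[_ lg _] _] _] := gc;
  rewrite (linfB (lg h)) (bb _ _ gc) subrr nrm0 mul0r.
Qed.

Lemma tensor_mxnorm_le k (a : 'M[TA]_k) L : 0 <= L ->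
  (forall (H : hilbertType R) (f : TA -> H -> H) (g : B -> H -> H),
    matching f g -> opmx_norm (map_mx f a) <= L) -> mxnorm k a <= L.
Proof.
move=> L0 aL; have [_ _ ->] := hTA; apply: sup_le => // _ [H [f [fc cf ->]]].
by have [g fg] := matching_exists fc cf; exact: aL fg.
Qed.

Lemma tensor_nrm_le a L : 0 <= L ->
  (forall (H : hilbertType R) (f : TA -> H -> H) (g : B -> H -> H),
    matching f g -> forall h, nrm (f a h) <= L * nrm h) -> nrm a <= L.
Proof.
move=> L0 aL; rewrite -mxnorm1; apply: tensor_mxnorm_le => // H f g fg.
by rewrite map_const_mx; apply: op_norm_le => // h; exact: aL fg h.
Qed.

Lemma tensor_ext a a' :
  (forall (H : hilbertType R) (f : TA -> H -> H) (g : B -> H -> H),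
    matching f g -> forall h, f a h = f a' h) -> a = a'.
Proof.
move=> aa; apply/eqP; rewrite -subr_eq0; apply/eqP/nrm0_eq0/eqP.
rewrite eq_le nrm_ge0 andbT; apply: tensor_nrm_le => // H f g fg h.
have [[[_ lf _] _] _ _ _] := fg.
by rewrite (linfB (lf h)) (aa _ _ _ fg) subrr nrm0 mul0r.
Qed.

Section CovrepFacts.
Context {H : hilbertType R} {g : B -> H -> H} (gc : covrep g).

Lemma covrep_unit h : g (j one) h = h.
Proof. by case: gc => _ [_ h1 _ _]; exact: h1. Qed.

Lemma covrep_star_rep : star_rep (g \o j).
Proof. by case: gc => _ []. Qed.

Lemma covrep_isometry i h : nrm (g (s i) h) = nrm h.
Proof. by case: gc => _ [_ _ [_ h1 _ _] _]; rewrite /nrm h1. Qed.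

Lemma covrep_orth i k h h' : i != k -> dot (g (s i) h) (g (s k) h') = 0.
Proof. by case: gc => _ [_ _ [_ _ h1 _] _] ik; exact: h1. Qed.

Lemma covrep_adjoint i : adjoint (g (s i)) = g (star (s i)).
Proof. by apply: adjoint_unique; case: gc => [[_ +] _]; apply. Qed.

Lemma covrep_alpha x h :
  g (j (alpha x)) h = \sum_i g (s i) (g (j x) (g (star (s i)) h)).
Proof.
case: gc => _ [_ _ _ hc]; rewrite [LHS]hc; apply: eq_bigr => i _.
by rewrite /= covrep_adjoint.
Qed.

Lemma covrep_cuntz h : \sum_i g (s i) (g (star (s i)) h) = h.
Proof.
rewrite -[RHS]covrep_unit -halpha1 covrep_alpha.
by apply: eq_bigr => i _; rewrite covrep_unit.
Qed.

Lemma covrep_rep : alg_rep g. Proof. by case: gc => -[]. Qed.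

Lemma covrepM b c h : g (b ** c) h = g b (g c h).
Proof. by case: covrep_rep. Qed.

Lemma covrep_linear h : linear (g^~ h).
Proof. by case: covrep_rep. Qed.

Lemma covrep_is_adjoint b : is_adjoint (g b) (g (star b)).
Proof. by case: gc => -[]. Qed.

Lemma covrep_contractive b h : nrm (g b h) <= nrm b * nrm h.
Proof. by apply: star_rep_contractive; case: gc. Qed.

End CovrepFacts.

Lemma stacey_gen_nrm i : nrm (s i) <= 1.
Proof.
by apply: stacey_nrm_le => // H g gc h; rewrite (covrep_isometry gc) mul1r.
Qed.

Lemma stacey_unit : is_unit (j one).
Proof.
move=> b; split; apply: stacey_ext => H g gc h.
  by rewrite (covrepM gc) (covrep_unit gc).
by rewrite (covrepM gc) (covrep_unit gc).
Qed.

(** For norm-preserving [T] with adjoint [T'], |T' T h - h|^2 = |T' T h|^2 - 2 |T h|^2 + |h|^2 <= 0,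
    because [T'] is contractive. *)
Lemma stacey_isometry i : star (s i) ** s i = j one.
Proof.
apply: stacey_ext => H g gc h; rewrite (covrep_unit gc) (covrepM gc).
apply/eqP; rewrite -subr_eq0; apply/eqP/nrm0_eq0/eqP; rewrite -sqrf_eq0.
rewrite eq_le sqr_ge0 andbT nrm2B (rdot_adj _ _ (is_adjoint_sym
  (covrep_is_adjoint gc _))).
rewrite rdot_nrm (covrep_isometry gc).
have : nrm (g (star (s i)) (g (s i) h)) <= nrm h.
  rewrite (le_trans (covrep_contractive gc _ _)) // (covrep_isometry gc).
  by rewrite ler_piMl ?nrm_ge0 // nrm_star stacey_gen_nrm.
rewrite -(ler_sqr (nrm_ge0 _) (nrm_ge0 _)); lra.
Qed.

Lemma stacey_orth i k : i != k -> star (s i) ** s k = 0.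
Proof.
move=> ik; apply: stacey_ext => H g gc h.
rewrite (linf0 (covrep_linear gc h)) (covrepM gc); apply: dot_injl => z.
rewrite -[g (s k) h]scale1r (is_adjoint_sym (covrep_is_adjoint gc _)) scale1r.
by rewrite covrep_orth // 1?eq_sym // -(scale0r z) dotZl mul0r.
Qed.

Lemma stacey_alpha x :
  j (alpha x) = \sum_i s i ** (j x ** star (s i)).
Proof.
apply: stacey_ext => H g gc h; rewrite (covrep_alpha gc).
rewrite (linf_sum (covrep_linear gc h)); apply: eq_bigr => i _.
by rewrite !(covrepM gc).
Qed.

Lemma stacey_j_linear : linear j.
Proof.
move=> a x y; apply: stacey_ext => H g gc h.
have [[_ l _] _] := covrep_star_rep gc.
by rewrite (covrep_linear gc) [LHS]l.
Qed.

Lemma stacey_jM x y : j (x ** y) = j x ** j y.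
Proof.
apply: stacey_ext => H g gc h; rewrite (covrepM gc).
by have [[_ _ m] _] := covrep_star_rep gc; rewrite [LHS]m.
Qed.

Lemma stacey_j_star x : j (star x) = star (j x).
Proof.
apply: stacey_ext => H g gc h; apply: dot_injr => z.
have [_ a] := covrep_star_rep gc.
by rewrite -(covrep_is_adjoint gc) -[LHS]a.
Qed.

(** The relations of a covariant pair hold in [B] itself, hence in all its representations; only
    unitality has to be enforced. *)
Lemma nondeg_covrep (H : hilbertType R) (f : B -> H -> H) (fs : star_rep f) :
  covrep (nondeg_rep stacey_unit fs).
Proof.
set g := nondeg_rep _ fs; have gs : star_rep g := nondeg_rep_star_rep _ fs.
have [[b l m] a] := gs.
have g1 h : g (j one) h = h by exact: nondeg_rep_unit.
have adj i : adjoint (g (s i)) = g (star (s i)) by apply: adjoint_unique.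
have galpha x h :
    g (j (alpha x)) h = \sum_i g (s i) (g (j x) (g (star (s i)) h)).
  rewrite stacey_alpha (linf_sum (l h)); apply: eq_bigr => i _.
  by rewrite !m.
split=> //; split => //.
- split; last by move=> x h k; rewrite /= stacey_j_star; exact: a.
  split; first by move=> x; exact: b.
    by move=> h c x y; rewrite /= stacey_j_linear l.
  by move=> x y h; rewrite /= stacey_jM m.
- split; first by move=> i; exact: b.
  + move=> i h; rewrite !normE; congr _%:C; apply/eqP.
    rewrite -(eqrXn2 (n := 2)) ?nrm_ge0 //= -!rdot_nrm.
    by rewrite (rdot_adj _ _ (a _)) -m stacey_isometry g1.
  + move=> i k ik h h'; rewrite /= a -m stacey_orth // (linf0 (l h')).
    by rewrite dot_conj -(scale0r h) dotZl mul0r conjc0.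
  + move=> h; rewrite (_ : \sum_i _ = h) //; have := galpha one h.
    rewrite halpha1 g1 => hE; rewrite [RHS]hE.
    by apply: eq_bigr => i _; rewrite /= adj g1.
- move=> x h; rewrite /= galpha; apply: eq_bigr => i _.
  by rewrite adj.
Qed.

(** The graph of the embedding of the tensor algebra into [B]. *)
Definition corr (b : TA) (c : B) : Prop :=
  forall (H : hilbertType R) (f : TA -> H -> H) (g : B -> H -> H),
    matching f g -> forall h, f b h = g c h.

Lemma corr_nrm b c b' c' : corr b c -> corr b' c' ->
  nrm (c - c') <= nrm (b - b').
Proof.
move=> bc bc'; apply: stacey_nrm_le => [|H g gc h]; first exact: nrm_ge0.
have [f fg] := covrep_matching gc; have [fc _ _ _] := fg.
rewrite (linfB (covrep_linear gc h)) -(bc _ _ _ fg) -(bc' _ _ _ fg).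
have [[_ l _] _] := fc; rewrite -(linfB (l h)); exact: cc_rep_nrm.
Qed.

Lemma corr_fun b c c' : corr b c -> corr b c' -> c = c'.
Proof.
move=> bc bc'; apply/eqP; rewrite -subr_eq0; apply/eqP/nrm0_eq0/eqP.
by rewrite eq_le nrm_ge0 (le_trans (corr_nrm bc bc')) // subrr nrm0.
Qed.

Lemma corr_closed b c : (forall e, 0 < e -> exists b' c',
    [/\ corr b' c', nrm (b - b') < e & nrm (c - c') < e]) -> corr b c.
Proof.
move=> bc H f g fg h; have [fc gc _ _] := fg; apply: nrm_eqP => e e0.
have h1 : 0 < nrm h + 1 by rewrite ltr_wpDl ?nrm_ge0.
set d := e / (2 * (nrm h + 1)).
have d0 : 0 < d by rewrite divr_gt0 // mulr_gt0.
have [b' [c' [bc' nb nc]]] := bc d d0.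
rewrite (le_trans (nrm_trans (f b' h) _ _)) // {2}(bc' _ _ _ fg).
have [[_ l _] _] := fc.
rewrite -(linfB (l h)) -(linfB (covrep_linear gc h)).
have hh : nrm h <= nrm h + 1 by rewrite lerDl.
have n1 : nrm (f (b - b') h) <= d * (nrm h + 1).
  rewrite (le_trans (cc_rep_nrm _ _ fc)) // ler_pM ?nrm_ge0 //; exact: ltW.
have n2 : nrm (g (c' - c) h) <= d * (nrm h + 1).
  rewrite (le_trans (covrep_contractive gc _ _)) // ler_pM ?nrm_ge0 //.
  by rewrite nrmC; exact: ltW.
rewrite (le_trans (lerD n1 n2)) // le_eqVlt; apply/orP; left; apply/eqP.
by rewrite /d; field; rewrite gt_eqF.
Qed.

Lemma corr0 : corr 0 0.
Proof.
move=> H f g [[[_ l _] _] gc _ _] h.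
by rewrite (linf0 (l h)) (linf0 (covrep_linear gc h)).
Qed.

Lemma corr_lin (a : R[i]) b c b' c' :
  corr b c -> corr b' c' -> corr (a *: b + b') (a *: c + c').
Proof.
move=> bc bc' H f g fg h; have [[[_ l _] _] gc _ _] := fg.
by rewrite l (covrep_linear gc) (bc _ _ _ fg) (bc' _ _ _ fg).
Qed.

Lemma corrM b c b' c' : corr b c -> corr b' c' -> corr (b ** b') (c ** c').
Proof.
move=> bc bc' H f g fg h; have [[[_ _ m] _] gc _ _] := fg.
by rewrite m (covrepM gc) (bc' _ _ _ fg) (bc _ _ _ fg).
Qed.

Lemma corr_iota x : corr (iota x) (j x).
Proof. by move=> H f g [_ _ fj _] h; rewrite fj. Qed.

Lemma corr_t i : corr (t i) (s i).
Proof. by move=> H f g [_ _ _ ft] h; rewrite ft. Qed.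

Lemma corr_word mu : corr (word (iota one) t mu) (word (j one) s mu).
Proof.
elim: mu => [|i mu ih] /=; first exact: corr_iota.
by apply: corrM => //; exact: corr_t.
Qed.

Lemma corr_total b : exists c, corr b c.
Proof.
have [gen _ _] := hTA.
apply: (opalg_generated_ind (P := fun b => exists c, corr b c) gen).
- by move=> x cx; exact: (closed_graph_domain corr_nrm corr_closed).
- split; first by exists 0; exact: corr0.
    by move=> a x y [c xc] [d yd]; exists (a *: c + d); exact: corr_lin.
  by move=> x y [c xc] [d yd]; exists (c ** d); exact: corrM.
- move=> _ [[x _ <-]|[mu _ <-]]; first by exists (j x); exact: corr_iota.
  by exists (word (j one) s mu); exact: corr_word.
Qed.

Definition tensor_incl (b : TA) : B := sval (cid (corr_total b)).
Local Notation eps := tensor_incl.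

Lemma tensor_inclP b : corr b (eps b).
Proof. exact: (svalP (cid (corr_total b))). Qed.

Lemma matching_incl (H : hilbertType R) (f : TA -> H -> H) g : matching f g ->
  f = g \o eps.
Proof. by move=> fg; apply/funext => b; apply/funext => h; exact:
  tensor_inclP. Qed.

Lemma tensor_incl_hom : alg_hom eps.
Proof.
split.
  move=> a x y; apply: (@corr_fun (a *: x + y)); first exact: tensor_inclP.
  by apply: corr_lin; exact: tensor_inclP.
move=> x y; apply: (@corr_fun (x ** y)); first exact: tensor_inclP.
by apply: corrM; exact: tensor_inclP.
Qed.

Lemma tensor_incl_iota x : eps (iota x) = j x.
Proof.
by apply: (@corr_fun (iota x)); [exact: tensor_inclP|exact: corr_iota].
Qed.

Lemma tensor_incl_t i : eps (t i) = s i.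
Proof. by apply: (@corr_fun (t i)); [exact: tensor_inclP|exact: corr_t]. Qed.

Lemma tensor_incl_word mu :
  eps (word (iota one) t mu) = word (j one) s mu.
Proof.
by apply: (@corr_fun (word (iota one) t mu)); [exact: tensor_inclP|exact:
  corr_word].
Qed.

Lemma covrep_incl (H : hilbertType R) (g : B -> H -> H) :
  covrep g -> matching (g \o eps) g.
Proof. by move=> gc; have [f fg] := covrep_matching gc;
  rewrite -(matching_incl fg). Qed.

(** The nondegenerate part of a representation of [B] carries its norm, is covariant and restricts
    to a completely contractive representation of [TA]. Conversely, the norm of [TA] is a supremum
    over restrictions [g \o eps]. *)
Lemma tensor_incl_mxnorm k (a : 'M[TA]_k) :
  cstar_mxnorm (map_mx eps a) = mxnorm k a.
Proof.
have cc (H : hilbertType R) (f : B -> H -> H) : star_rep f ->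
    opmx_norm (map_mx f (map_mx eps a)) <= mxnorm k a.
  move=> fs; rewrite (le_trans (opmx_nondeg_rep stacey_unit fs _)) //.
  have [[_ h] _ _ _] := covrep_incl (nondeg_covrep fs).
  by rewrite -map_mx_comp; exact: h.
have m0 : 0 <= mxnorm k a.
  by have [_ _ ->] := hTA; apply: sup_ge0 => _ [H [f [_ _ ->]]]; exact:
    opmx_ge0.
apply/le_anti/andP; split.
  by apply: sup_le => // _ [H [f [fs ->]]]; exact: cc.
apply: tensor_mxnorm_le => [|H f g fg].
  by apply: sup_ge0 => _ [H [f [_ ->]]]; exact: opmx_ge0.
rewrite (matching_incl fg) map_mx_comp; apply: star_rep_cstar_mxnorm.
by case: fg => _ [].
Qed.

Lemma tensor_incl_cover : cstar_cover eps.
Proof.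
split; [exact: tensor_incl_hom|exact: tensor_incl_mxnorm|].
move=> S cS sS epsS; have [gen _ _] := hB; apply: (gen S cS sS).
move=> _ [x [nu [mu ->]]]; have [[_ _ SM] Sst] := sS.
apply: (SM); last by rewrite -tensor_incl_word; apply: Sst; apply: epsS;
  eexists.
apply: SM; first by rewrite -tensor_incl_iota; apply: epsS; eexists.
by rewrite -tensor_incl_word; apply: epsS; eexists.
Qed.

Lemma tensor_unit : is_unit (iota one).
Proof.
move=> b; split; apply: tensor_ext => H f g fg h;
  have [[[_ _ m] _] gc fi _] := fg; rewrite m fi (covrep_unit gc) //.
Qed.

(** * Vector states on C*-covers *)

(** The real part of the vector functional <phi(a) h, h> on the k-fold direct sum of [K]. *)
Definition qform (K : hilbertType R) (phi : TA -> K -> K) k (a : 'M[TA]_k)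
    (h : 'I_k -> K) : R :=
  \sum_i rdot (mxact (map_mx phi a) h i) (h i).

Lemma tensor_unit_nrm : nrm (iota one) <= 1.
Proof.
apply: tensor_nrm_le => // H f g [_ gc fi _] h.
by rewrite fi (covrep_unit gc) mul1r.
Qed.

Section ContractiveRep.
Context {K : hilbertType R} {phi : TA -> K -> K} (cphi : cc_rep phi).
Local Notation p := (phi (iota one)).

Lemma cc_rep_linear a : linear (phi a).
Proof. by case: cphi => [[b _ _] _]; case: (b a). Qed.

Lemma cc_rep_linearl h : linear (phi^~ h).
Proof. by case: cphi => [[_ l _] _]. Qed.

Lemma cc_repM a b h : phi (a ** b) h = phi a (phi b h).
Proof. by case: cphi => [[_ _ m] _]. Qed.

Lemma cc_rep_unit a h : p (phi a h) = phi a h /\ phi a (p h) = phi a h.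
Proof. by rewrite -!cc_repM; have [-> ->] := tensor_unit a. Qed.

Lemma cc_rep_unit_nrm h : nrm (p h) <= nrm h.
Proof.
by rewrite (le_trans (cc_rep_nrm _ _ cphi)) // ler_piMl ?nrm_ge0 //
  tensor_unit_nrm.
Qed.

Lemma cc_rep_unit_adj x y : rdot (p x) y = rdot x (p y).
Proof.
apply: contractive_idempotent_adj => [|z|z].
- exact: cc_rep_linear.
- by case: (cc_rep_unit (iota one) z).
- exact: cc_rep_unit_nrm.
Qed.

Lemma cc_rep_mx_bound k (a : 'M[TA]_k) h :
  sqnorm (mxact (map_mx phi a) h) <= mxnorm k a ^+ 2 * sqnorm h.
Proof.
apply: le_trans (opmx_bound _ _) _ => [i l|].
  by exact: rep_mx_bounded cphi.1.
rewrite ler_wpM2r ?sqnorm_ge0 // ler_sqr ?nnegrE ?opmx_ge0 //.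
  exact: cphi.2.
exact: le_trans (opmx_ge0 _) (cphi.2 _ _).
Qed.

Lemma qformE k (a : 'M[TA]_k) h :
  qform phi a h = \sum_i \sum_j rdot (phi (a i j) (h j)) (h i).
Proof.
apply: eq_bigr => i _; rewrite /mxact rdot_suml; apply: eq_bigr => l _.
by rewrite mxE.
Qed.

Lemma qform_lin m k (c : 'I_m -> R) (a : 'I_m -> 'M[TA]_k) h :
  qform phi (\matrix_(i, l) \sum_q (c q)%:C *:
    a q i l) h = \sum_q c q * qform phi (a q) h.
Proof.
under [RHS]eq_bigr => q _ do rewrite qformE mulr_sumr.
rewrite qformE [RHS]exchange_big /=; apply: eq_bigr => i _.
under [RHS]eq_bigr => q _ do rewrite mulr_sumr.
rewrite [RHS]exchange_big /=; apply: eq_bigr => l _.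
rewrite mxE (linf_sum (cc_rep_linearl _)) rdot_suml; apply: eq_bigr => q _.
by rewrite (linfZ (cc_rep_linearl _)) rdotZl.
Qed.

Lemma qformZ k (a : 'M[TA]_k) (c : R) h :
  qform phi a (fun i => c%:C *: h i) = c ^+ 2 * qform phi a h.
Proof.
rewrite !qformE mulr_sumr; apply: eq_bigr => i _; rewrite mulr_sumr.
apply: eq_bigr => l _; rewrite (linfZ (cc_rep_linear _)) rdotZl rdotZr.
by rewrite mulrA expr2.
Qed.

(** Not sharp: the bound only supplies the constant [M] of [cone_approx]. *)
Lemma qform_le k (a : 'M[TA]_k) h :
  qform phi a h ^+ 2 <= (mxnorm k a ^+ 2 + 1) ^+ 2 * sqnorm h ^+ 2.
Proof.
have b0 : 0 <= (mxnorm k a ^+ 2 + 1) * sqnorm h.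
  by rewrite mulr_ge0 ?sqnorm_ge0 // addr_ge0 ?sqr_ge0.
rewrite -exprMn -[leLHS]real_normK ?num_real // ler_sqr ?nnegrE //.
have := cc_rep_mx_bound a h => hb.
rewrite ler_norml mulrDl mul1r; apply/andP; split; last first.
  apply: le_trans (lerD hb (lexx _)); rewrite /sqnorm -big_split ler_sum //= =>
    i _.
  exact: rdot_le.
rewrite lerNl; apply: le_trans (lerD hb (lexx _)).
rewrite /qform -sumrN /sqnorm -big_split ler_sum //= => i _.
by rewrite -rdotNl (le_trans (rdot_le _ _)) // nrmN.
Qed.

(** The unit acts as a self-adjoint projection [p] fixing the range of every [phi a], so [p] drops
    out of the cross term. *)
Lemma perturbed_unit_sqnorm k (a : 'M[TA]_k) (e : R) h :
  sqnorm (mxact (map_mx phi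
    (\matrix_(i, l) ((if i == l then iota one else 0) + e%:C *: a i l))) h) =
  sqnorm (fun i => p (h i)) + 2 * e * qform phi a h
    + e ^+ 2 * sqnorm (mxact (map_mx phi a) h).
Proof.
rewrite /qform /sqnorm !mulr_sumr -!big_split /=; apply: eq_bigr => i _.
set v := mxact (map_mx phi a) h i.
have -> : mxact (map_mx phi (\matrix_(i, l) ((if i == l then iota one else 0)
    + e%:C *: a i l))) h i = p (h i) + e%:C *: v.
  rewrite /v /mxact scaler_sumr (bigD1 i) //= [in RHS](bigD1 i) //= addrA.
  congr (_ + _).
    by rewrite !mxE eqxx (linfD (cc_rep_linearl _)) (linfZ (cc_rep_linearl _)).
  apply: eq_bigr => l li; rewrite !mxE eq_sym (negbTE li) add0r.
  by rewrite (linfZ (cc_rep_linearl _)).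
rewrite nrm2D rdotZr nrmZr exprMn real_normK ?num_real //.
rewrite mulrA [rdot (p _) _]cc_rep_unit_adj.
suff -> : p v = v by rewrite (rdotC (h i)).
rewrite /v /mxact (linf_sum (cc_rep_linear _)); apply: eq_bigr => l _.
by rewrite mxE; case: (cc_rep_unit (a i l) (h l)).
Qed.

End ContractiveRep.

Section Cover.
Context {C : cstarAlgType R} {rho : TA -> C} (hrho : cstar_cover rho).

Lemma cover_cc_rep (K : hilbertType R) (sg : C -> K -> K) :
  star_rep sg -> cc_rep (sg \o rho).
Proof.
move=> ss; have [[lr mr] nr _] := hrho; have [[b l m] _] := ss.
split; first split.
- by move=> x; exact: b.
- by move=> h c x y; rewrite /= lr l.
- by move=> x y h; rewrite /= mr m.
- move=> k c; rewrite -nr map_mx_comp; exact: star_rep_cstar_mxnorm.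
Qed.

(* Complete isometry at 1 + e a, compared to first order in e. *)
Lemma numerical_range_transfer k (a : 'M[TA]_k) gam : 0 <= gam ->
  (forall (K : hilbertType R) (sg : C -> K -> K) h, star_rep sg ->
    qform (sg \o rho) a h <= gam * sqnorm h) ->
  forall (H : hilbertType R) (f : TA -> H -> H) (g : B -> H -> H) h,
    matching f g -> qform f a h <= gam * sqnorm h.
Proof.
move=> gam0 ha H f g h fg; have [fc gc fi _] := fg.
set M := mxnorm k a; set N := sqnorm h; have N0 : 0 <= N := sqnorm_ge0 h.
have key e : 0 < e -> qform f a h <= gam * N + e * (M ^+ 2 * N).
  move=> e0; set E := \matrix_(i, l) ((if i == l then iota one else 0) + e%:C
    *: a i l).
  (* Bounds |1 + e a|^2 in all representations of [C]; after division by [2 e] its last term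
     vanishes with [e]. *)
  set L2 := 1 + 2 * e * gam + e ^+ 2 * M ^+ 2.
  have L20 : 0 <= L2.
    by rewrite !addr_ge0 // mulr_ge0 ?sqr_ge0 // mulr_ge0 // ltW.
  have EL : mxnorm k E <= Num.sqrt L2.
    have [_ <- _] := hrho; apply: sup_le; first exact: sqrtr_ge0.
    move=> _ [K [sg [ss ->]]]; have cs := cover_cc_rep ss.
    rewrite -map_mx_comp; apply: opmx_le => [|y]; first exact: sqrtr_ge0.
    rewrite (perturbed_unit_sqnorm cs) sqr_sqrtr //.
    have -> : L2 * sqnorm y = sqnorm y + 2 * e * (gam * sqnorm y)
        + e ^+ 2 * (M ^+ 2 * sqnorm y) by rewrite /L2; ring.
    apply: lerD; first apply: lerD.
    - rewrite ler_sum // => i _; rewrite ler_sqr ?nnegrE ?nrm_ge0 //.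
      exact: cc_rep_unit_nrm.
    - by rewrite ler_pM2l ?mulr_gt0 // ha.
    - by rewrite ler_wpM2l ?sqr_ge0 // (cc_rep_mx_bound cs).
  have := cc_rep_mx_bound fc E h; rewrite (perturbed_unit_sqnorm fc).
  (* In a covariant representation the unit is the identity, so the terms of order zero cancel
     exactly; in those of [C] an inequality is enough. *)
  have -> : sqnorm (fun i => f (iota one) (h i)) = N.
    by apply: eq_bigr => i _; rewrite fi (covrep_unit gc).
  move=> h1; have h2 : mxnorm k E ^+ 2 <= L2.
    rewrite -[leRHS]sqr_sqrtr // ler_sqr ?nnegrE ?sqrtr_ge0 //.
    exact: le_trans (opmx_ge0 _) (fc.2 _ E).
  have h3 := ler_wpM2r N0 h2.
  have h4 : 0 <= e ^+ 2 * sqnorm (mxact (map_mx f a) h).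
    by rewrite mulr_ge0 ?sqr_ge0 ?sqnorm_ge0.
  have e2 : 0 < 2 * e by rewrite mulr_gt0.
  have MN : 0 <= e * e * (M ^+ 2 * N).
    by rewrite -expr2 mulr_ge0 ?sqr_ge0 // mulr_ge0 ?sqr_ge0.
  rewrite -(ler_pM2l e2).
  move: h1 h3 h4 MN; rewrite /L2 -/N; move: (qform f a h) (sqnorm (mxact _ _)).
  by move=> x y; move: (M ^+ 2) (mxnorm k E ^+ 2) => u v; lra.
apply/ler_addgt0Pl => e e0.
have MN : 0 <= M ^+ 2 * N by rewrite mulr_ge0 ?sqr_ge0.
have d0 : 0 < e / (M ^+ 2 * N + 1) by rewrite divr_gt0 // ltr_wpDl.
rewrite (le_trans (key _ d0)) // addrC lerD2r mulrAC ler_pdivrMr ?ltr_wpDl //.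
by rewrite ler_pM2l // lerDl.
Qed.

Lemma zero_star_rep (H : hilbertType R) : star_rep (fun (_ : C) (_ : H) => 0 :
  H).
Proof.
have d0 (x : H) : dot 0 x = 0 by rewrite -(scale0r x) dotZl mul0r.
split; first split.
- move=> x; split; first by move=> c u v; rewrite scaler0 addr0.
  by exists 0 => h; rewrite nrm0 mul0r.
- by move=> h c u v; rewrite scaler0 addr0.
- by [].
- by move=> x u v; rewrite d0 dot_conj d0 conjc0.
Qed.

Lemma dsum_qform (K1 K2 : hilbertType R) (s1 : C -> K1 -> K1)
    (s2 : C -> K2 -> K2) k (a : 'M[TA]_k) h1 h2 :
  star_rep s1 -> star_rep s2 ->
  qform (dsum_rep s1 s2 \o rho) a (fun i => (h1 i, h2 i) : dsum K1 K2) =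
  qform (s1 \o rho) a h1 + qform (s2 \o rho) a h2.
Proof.
move=> ss1 ss2; have ss := dsum_rep_star_rep ss1 ss2.
rewrite !qformE -big_split; apply: eq_bigr => i _ /=.
rewrite -big_split; apply: eq_bigr => l _ /=.
by rewrite /rdot {1}/dot /= /dsum_dot /= raddfD.
Qed.

Lemma dsum_sqnorm (K1 K2 : hilbertType R) k (h1 : 'I_k -> K1) (h2 : 'I_k ->
  K2) :
  sqnorm (fun i => (h1 i, h2 i) : dsum K1 K2) = sqnorm h1 + sqnorm h2.
Proof.
rewrite /sqnorm -big_split; apply: eq_bigr => i _.
by rewrite dsum_nrmE dsum_nrm2.
Qed.

(** The vector functionals of all representations of [C] form a convex cone: direct sums add them,
    and scaling a vector by the square root of [c] multiplies them by [c]. *)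
Lemma vector_state_approx (H : hilbertType R) (g : B -> H -> H) k
    (h : 'I_k -> H) m (a : 'I_m -> 'M[TA]_k) (e : R) : covrep g -> 0 < e ->
  exists (K : hilbertType R) (sg : C -> K -> K) (kap : 'I_k -> K),
    star_rep sg /\
    forall q, `|qform (g \o eps) (a q) h - qform (sg \o rho) (a q) kap| <= e.
Proof.
move=> gc e0; have fg := covrep_incl gc; have [fc _ _ _] := fg.
pose S v b := exists (K : hilbertType R) (sg : C -> K -> K) (kap : 'I_k -> K),
  [/\ star_rep sg, forall q : 'I_m, v q = qform (sg \o rho) (a q) kap
    & b = sqnorm kap].
have [|||||||v [b [[K [sg [kap [ss vE _]]]] hv]]] :=
  @cone_approx R m S (\sum_q (mxnorm k (a q) ^+ 2 + 1) ^+ 2) (sqnorm h)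
    (fun q => qform (g \o eps) (a q) h) _ _ _ _ _ _ _ e e0.
- by rewrite sumr_ge0 // => q _; rewrite sqr_ge0.
- exact: sqnorm_ge0.
- have zs := zero_star_rep H; exists H, (fun _ _ => 0), (fun=> 0); split => //.
    move=> q; rewrite qformE big1 // => i _; rewrite big1 // => l _.
    by rewrite /= rdot0l.
  by rewrite /sqnorm big1 // => i _; rewrite nrm0 expr0n.
- move=> u v b c [K1 [s1 [k1 [ss1 uE ->]]]] [K2 [s2 [k2 [ss2 vE ->]]]].
  exists (dsum K1 K2), (dsum_rep s1 s2), (fun i => (k1 i, k2 i)); split.
  + exact: dsum_rep_star_rep.
  + by move=> q; rewrite dsum_qform // uE vE.
  + by rewrite dsum_sqnorm.
- move=> c v b c0 [K [sg [kap [ss vE ->]]]].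
  exists K, sg, (fun i => (Num.sqrt c)%:C *: kap i); split => //.
    by move=> q; rewrite (qformZ (cover_cc_rep ss)) sqr_sqrtr // vE.
  by rewrite sqnormZ sqr_sqrtr.
- move=> v b [K [sg [kap [ss vE ->]]]]; split; first exact: sqnorm_ge0.
  rewrite mulr_suml ler_sum // => q _; rewrite vE.
  exact: (qform_le (cover_cc_rep ss)).
(* A separating functional [lam] is the single matrix with entries [\sum_q lam q * a q i l], to
   which [numerical_range_transfer] applies. *)
- move=> lam gam gam0 hl.
  rewrite -(qform_lin fc); apply: numerical_range_transfer fg => //.
  move=> K sg kap ss; rewrite (qform_lin (cover_cc_rep ss)); apply: hl.
  by exists K, sg, kap.
exists K, sg, kap; split => // q; by rewrite -vE.
Qed.

(** * Asymptotic compressions *)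

Section Asymptotics.
Context {H : hilbertType R} {g : B -> H -> H} (gc : covrep g).

(* The map from H is not assumed linear; linearity, like isometry, only holds
   asymptotically. *)
Record approximant := Approximant {
  ap_space : hilbertType R;
  ap_rep : C -> ap_space -> ap_space;
  ap_map : H -> ap_space;
  ap_star_rep : star_rep ap_rep;
  ap_unit : forall x, ap_rep (rho (iota one)) (ap_map x) = ap_map x }.

Arguments ap_rep : clear implicits.
Arguments ap_map : clear implicits.

Implicit Type q : approximant.
Local Notation sg q := (ap_rep q).
Local Notation V q := (ap_map q).

(* P lists the coefficients <g(eps a) x, y> to be reproduced up to d. *)
Definition eventually_ap (Q : approximant -> Prop) : Prop :=
  exists (P : seq (TA * H * H)) (d : R), 0 < d /\ forall q,
    (forall u, u \in P ->
      `|rdot (sg q (rho u.1.1) (V q u.1.2)) (V q u.2)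
        - rdot (g (eps u.1.1) u.1.2) u.2| <= d) -> Q q.

Lemma eventually_mono (Q Q' : approximant -> Prop) :
  (forall q, Q q -> Q' q) -> eventually_ap Q -> eventually_ap Q'.
Proof. by move=> QQ' [P [d [d0 PQ]]]; exists P, d; split => // q /PQ /QQ'. Qed.

Lemma eventually_and (Q Q' : approximant -> Prop) :
  eventually_ap Q -> eventually_ap Q' -> eventually_ap (fun q => Q q /\ Q' q).
Proof.
move=> [P [d [d0 PQ]]] [P' [d' [d0' PQ']]]; exists (P ++ P'), (Num.min d d').
split; first by rewrite lt_min d0 d0'.
move=> q hq; split; [apply: PQ|apply: PQ'] => u uP.
  by apply: le_trans (hq _ _) _; rewrite ?mem_cat ?uP // ge_min lexx.
by apply: le_trans (hq _ _) _; rewrite ?mem_cat ?uP ?orbT // ge_min lexx orbT.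
Qed.

(** Properness of the filter. All vectors of the list are treated as one vector [h] of a direct sum,
    for which [vector_state_approx] gives a simultaneous approximation. *)
Lemma eventually_ex (Q : approximant -> Prop) : eventually_ap Q ->
  exists q, Q q.
Proof.
move=> [P [d [d0 PQ]]].
pose xs := [seq u.1.2 | u <- P] ++ [seq u.2 | u <- P].
pose T := 'I_(size P).
pose u (o : T) : TA * H * H := tnth (in_tuple P) o.
have uP (o : T) : u o \in P by exact: mem_tnth.
have x1 (o : T) : (index (u o).1.2 xs < size xs)%N.
  by rewrite index_mem mem_cat (map_f (fun u => u.1.2) (uP o)).
have x2 (o : T) : (index (u o).2 xs < size xs)%N.
  by rewrite index_mem mem_cat (map_f (fun u => u.2) (uP o)) orbT.
pose h (i : 'I_(size xs)) := nth 0 xs i.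
(* A single nonzero entry, in the row of [y] and the column of [x], makes [qform] the coefficient <a
   x, y>. *)
pose a (o : T) : 'M[TA]_(size xs) := \matrix_(i, l)
  if (i == Ordinal (x2 o)) && (l == Ordinal (x1 o)) then (u o).1.1 else 0.
have [K [s0 [kap [ss hk]]]] := vector_state_approx h a gc d0.
have cs := cover_cc_rep ss; have [cg _ _ _] := covrep_incl gc.
have aE (K' : hilbertType R) (phi : TA -> K' -> K') (k : 'I_(size xs) ->
  K') (o : T) :
    cc_rep phi -> qform phi (a o) k =
    rdot (phi (u o).1.1 (k (Ordinal (x1 o)))) (k (Ordinal (x2 o))).
  move=> cphi; rewrite qformE (bigD1 (Ordinal (x2 o))) //=.
  rewrite (bigD1 (Ordinal (x1 o))) //= mxE !eqxx /= big1 ?addr0 => [|l ll].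
    rewrite big1 ?addr0 // => i ii; rewrite big1 // => l _.
    by rewrite mxE (negbTE ii) (linf0 (cc_rep_linearl cphi _)) rdot0l.
  by rewrite mxE eqxx (negbTE ll) (linf0 (cc_rep_linearl cphi _)) rdot0l.
pose p := s0 (rho (iota one)).
(* Vectors outside the list go to 0. The projection [p] provides [ap_unit] and changes no
   coefficient, being self-adjoint and a two-sided unit for the image of the tensor algebra. *)
pose W x := if insub (index x xs) is Some i then p (kap i) else 0.
have pW x : p (W x) = W x.
  rewrite /W; case: insubP => [i _ _|_].
    by case: (cc_rep_unit cs (iota one) (kap i)).
  exact: (linf0 (cc_rep_linear cs (iota one))).
exists (Approximant ss pW); apply: PQ => v vP /=.
have [i iE] : exists i : T, u i = v.
  move: (vP); rewrite -index_mem => vi; exists (Ordinal vi).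
  by rewrite /u (tnth_nth v) /= nth_index.
have := hk i; rewrite !aE // distrC -iE.
have hE x (xi : (index x xs < size xs)%N) : h (Ordinal xi) = x.
  by rewrite /h /= nth_index // -index_mem.
have WE x (xi : (index x xs < size xs)%N) : W x = p (kap (Ordinal xi)).
  by rewrite /W (insubT (fun i => (i < size xs)%N) xi).
rewrite !hE (WE _ (x1 i)) (WE _ (x2 i)) /=.
set k1 := kap _; set k2 := kap _; set y := s0 (rho (u i).1.1) k1.
have [e1 e2] : p y = y /\ s0 (rho (u i).1.1) (p k1) = y.
  exact: (cc_rep_unit cs (u i).1.1 k1).
have -> : rdot (s0 (rho (u i).1.1) (p k1)) (p k2) = rdot y k2.
  by rewrite e2 -{2}e1; have /= <- := cc_rep_unit_adj cs y k2.
exact.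
Qed.

(** * Limits along the approximants *)

Definition tends (F : approximant -> R) (l : R) : Prop :=
  forall e, 0 < e -> eventually_ap (fun q => `|F q - l| <= e).

Lemma tends_const l : tends (fun=> l) l.
Proof.
move=> e e0; exists [::], 1; split => // q _.
by rewrite subrr normr0 ltW.
Qed.

Lemma tends_ext F G l : (forall q, F q = G q) -> tends F l -> tends G l.
Proof. by move=> FG Fl e /Fl; apply: eventually_mono => q; rewrite FG. Qed.

Lemma tendsD F G l m : tends F l -> tends G m -> tends (fun q =>
  F q + G q) (l + m).
Proof.
move=> Fl Gm e e0; have e2 : 0 < e / 2 by rewrite divr_gt0.
apply: eventually_mono (eventually_and (Fl _ e2) (Gm _ e2)) => q [h1 h2].
by rewrite opprD addrACA (le_trans (ler_normD _ _)) // [leRHS]splitr lerD.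
Qed.

Lemma tendsZ F l c : tends F l -> tends (fun q => c * F q) (c * l).
Proof.
move=> Fl e e0; have d0 : 0 < e / (`|c| + 1) by rewrite divr_gt0 // ltr_wpDl.
apply: eventually_mono (Fl _ d0) => q; rewrite -mulrBr normrM.
rewrite ler_pdivlMr ?ltr_wpDl // => h; apply: le_trans h.
by rewrite mulrC ler_wpM2l // lerDl.
Qed.

Lemma tends_sum (I : finType) (F : I -> approximant -> R) (l : I -> R) :
  (forall i, tends (F i) (l i)) ->
  tends (fun q => \sum_i F i q) (\sum_i l i).
Proof.
move=> Fl; elim: (index_enum I) => [|i r ih].
  by rewrite big_nil; apply: tends_ext (tends_const 0) => q; rewrite big_nil.
rewrite big_cons; apply: tends_ext (tendsD (Fl i) ih) => q.
by rewrite big_cons.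
Qed.

(** Here properness, [eventually_ex], turns limit statements into inequalities between numbers. *)
Lemma tends_le F G l m : (forall q, F q <= G q) -> tends F l -> tends G m ->
  l <= m.
Proof.
move=> FG Fl Gm; apply/ler_addgt0Pl => e e0.
have e2 : 0 < e / 2 by rewrite divr_gt0.
have [q []] := eventually_ex (eventually_and (Fl _ e2) (Gm _ e2)).
by have := FG q; rewrite !ler_norml => ? /andP[? ?] /andP[? ?]; lra.
Qed.

Lemma tends_squeeze F G : (forall q, 0 <= F q <= G q) -> tends G 0 -> tends F 0.
Proof.
move=> FG G0 e e0; apply: eventually_mono (G0 e e0) => q; rewrite !subr0.
have /andP[F0 h] := FG q; rewrite !ger0_norm //; first exact: le_trans.
exact: le_trans h.
Qed.

(** |F - l|^2 <= |F - l| (F + l) = |F^2 - l^2| for nonnegative values. *)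
Lemma tends_sqr F l : (forall q, 0 <= F q) -> 0 <= l ->
  tends (fun q => F q ^+ 2) (l ^+ 2) -> tends F l.
Proof.
move=> F0 l0 Fl e e0; have e2 : 0 < e ^+ 2 by rewrite exprn_gt0.
apply: eventually_mono (Fl _ e2) => q h; have := F0 q => Fq.
apply: ler_sqrW; first exact: ltW.
rewrite (le_trans _ h) // subr_sqr normrM expr2 ler_wpM2l //.
by rewrite (le_trans (ler_normB _ _)) // !ger0_norm // ?addr_ge0.
Qed.

Lemma tends_test a x y :
  tends (fun q => rdot (sg q (rho a) (V q x)) (V q y)) (rdot (g (eps a) x) y).
Proof.
move=> e e0; exists [:: (a, x, y)], e; split => // q hq.
by have := hq (a, x, y); rewrite inE eqxx; apply.
Qed.

(** The coefficient of the unit, which fixes [V q x] by [ap_unit]. *)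
Lemma tends_gram x y : tends (fun q => rdot (V q x) (V q y)) (rdot x y).
Proof.
have := tends_test (iota one) x y; rewrite tensor_incl_iota (covrep_unit gc).
by apply: tends_ext => q; rewrite ap_unit.
Qed.

(** The choice [c = i] gives the imaginary part of the Gram coefficient. *)
Lemma tends_gramC (c : R[i]) x y :
  tends (fun q => rdot (c *: V q x) (V q y)) (rdot (c *: x) y).
Proof.
have := tends_test (c *: iota one) x y.
rewrite (linfZ tensor_incl_hom.1) tensor_incl_iota.
rewrite (linfZ (covrep_linear gc x)) (covrep_unit gc).
have [[lr _] _ _] := hrho; apply: tends_ext => q.
by rewrite (linfZ lr) (linfZ (rep_linearl _ (ap_star_rep q).1)) ap_unit.
Qed.

Lemma tends_nrm2 x : tends (fun q => nrm (V q x) ^+ 2) (nrm x ^+ 2).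
Proof.
rewrite -rdot_nrm; apply: tends_ext (tends_gram x x) => q.
exact: rdot_nrm.
Qed.

Lemma tends_nrm x : tends (fun q => nrm (V q x)) (nrm x).
Proof.
apply: tends_sqr (tends_nrm2 x) => [q|]; exact: nrm_ge0.
Qed.

Lemma tends_nrmB x y : tends (fun q => nrm (V q x - V q y)) (nrm (x - y)).
Proof.
apply: tends_sqr => [q||]; [exact: nrm_ge0|exact: nrm_ge0|].
rewrite nrm2B -mulNr.
apply: tends_ext (tendsD (tendsD (tends_nrm2 x) (tendsZ (- 2) (tends_gram x y)))
  (tends_nrm2 y)) => q.
by rewrite nrm2B mulNr.
Qed.

Definition vanishes (v : forall q, ap_space q) : Prop :=
  tends (fun q => nrm (v q)) 0.

Lemma vanishesD v w : vanishes v -> vanishes w -> vanishes (fun q => v q + w q).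
Proof.
move=> v0 w0; apply: tends_squeeze (_ : tends (fun q =>
  nrm (v q) + nrm (w q)) 0).
  by move=> q; rewrite nrm_ge0 nrmD.
by rewrite -[0]addr0; exact: tendsD.
Qed.

Lemma vanishes_bounded v w M : (forall q, nrm (w q) <= M * nrm (v q)) ->
  vanishes v -> vanishes w.
Proof.
move=> wv v0; apply: tends_squeeze (_ : tends (fun q => M * nrm (v q)) 0).
  by move=> q; rewrite nrm_ge0 wv.
by rewrite -(mulr0 M); exact: tendsZ.
Qed.

Lemma vanishes_sqr v G : (forall q, nrm (v q) ^+ 2 <= G q) -> tends G 0 ->
  vanishes v.
Proof.
move=> vG G0; apply: tends_sqr => // [q|]; first exact: nrm_ge0.
rewrite expr0n; apply: tends_squeeze G0 => q.
by rewrite sqr_ge0 vG.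
Qed.

(** Gram coefficients converge, so the squared defect tends to |(x + y) - (x + y)|^2 = 0. *)
Lemma vanishes_add x y : vanishes (fun q => V q (x + y) - (V q x + V q y)).
Proof.
apply: (@vanishes_sqr _ (fun q => nrm (V q (x + y)) ^+ 2
   + - 2 * (rdot (V q (x + y)) (V q x) + rdot (V q (x + y)) (V q y))
   + (nrm (V q x) ^+ 2 + 2 * rdot (V q x) (V q y) + nrm (V q y) ^+ 2))) => [q|].
  by rewrite nrm2B nrm2D rdotDr mulNr.
have -> : 0 = nrm (x + y) ^+ 2 + - 2 * (rdot (x + y) x + rdot (x + y) y)
    + (nrm x ^+ 2 + 2 * rdot x y + nrm y ^+ 2).
  by rewrite -rdotDr rdot_nrm nrm2D; ring.
have t2 := tends_nrm2; have tg := tends_gram.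
exact: tendsD (tendsD (t2 _) (tendsZ _ (tendsD (tg _ _) (tg _ _))))
  (tendsD (tendsD (t2 _) (tendsZ _ (tg _ _))) (t2 _)).
Qed.

Lemma vanishes_scale (c : R[i]) x : vanishes (fun q => V q (c *: x) - c *:
  V q x).
Proof.
set m := complex.Re `|c|.
have cE (K : hilbertType R) (y : K) : nrm (c *: y) ^+ 2 = m ^+ 2 * nrm y ^+ 2.
  by rewrite nrmZ exprMn.
apply: (@vanishes_sqr _ (fun q => nrm (V q (c *: x)) ^+ 2
   + - 2 * rdot (c *: V q x) (V q (c *: x)) + m ^+ 2 * nrm (V q x) ^+ 2)) =>
     [q|].
  by rewrite nrm2B cE (rdotC (V q _)) mulNr.
have -> : 0 = nrm (c *: x) ^+ 2 + - 2 * rdot (c *: x) (c *: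
  x) + m ^+ 2 * nrm x ^+ 2.
  by rewrite rdot_nrm -cE; ring.
exact: tendsD (tendsD (tends_nrm2 _) (tendsZ _ (tends_gramC _ _ _)))
  (tendsZ _ (tends_nrm2 _)).
Qed.

(** The intertwining relation [sg(c) V = V g(b)] in the limit; unlike a statement about
    compressions, it is multiplicative. *)
Definition asym (c : C) (b : B) : Prop :=
  forall x, vanishes (fun q => sg q c (V q x) - V q (g b x)).

Lemma asym_lin (a : R[i]) c b c' b' :
  asym c b -> asym c' b' -> asym (a *: c + c') (a *: b + b').
Proof.
move=> cb cb' x.
have h1 : vanishes (fun q => a *: (sg q c (V q x) - V q (g b x))).
  by apply: vanishes_bounded (cb x) => q; rewrite nrmZ.
have h2 : vanishes (fun q => - (V q (a *: g b x) - a *: V q (g b x))).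
  apply: (vanishes_bounded (M := 1)) (vanishes_scale a (g b x)) => q.
  by rewrite nrmN mul1r.
have h3 : vanishes (fun q => - (V q (a *: g b x + g b' x)
    - (V q (a *: g b x) + V q (g b' x)))).
  apply: (vanishes_bounded (M := 1)) (vanishes_add (a *: g b x) (g b' x)) => q.
  by rewrite nrmN mul1r.
have h := vanishesD (vanishesD h1 (cb' x)) (vanishesD h2 h3).
apply: (vanishes_bounded (M := 1)) h => q; rewrite mul1r.
rewrite (covrep_linear gc) (rep_linearl _ (ap_star_rep q).1).
rewrite le_eqVlt; apply/orP; left; apply/eqP; congr nrm.
rewrite scalerBr !opprB; set u := V q (_ *: _); set w := V q (g b' x).
exact: sub_telescope.
Qed.

Lemma asymM c b c' b' : asym c b -> asym c' b' -> asym (c ** c') (b ** b').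
Proof.
move=> cb cb' x.
have h1 : vanishes (fun q => sg q c (sg q c' (V q x) - V q (g b' x))).
  by apply: vanishes_bounded (cb' x) => q; apply: star_rep_contractive; case: q.
apply: (vanishes_bounded (M := 1)) (vanishesD h1 (cb (g b' x))) => q.
have sq := (ap_star_rep q).1; have [_ _ m] := sq.
by rewrite (covrepM gc) m (linfB (rep_linear _ sq)) addrA subrK mul1r.
Qed.

(** Closeness of [c] and [c'] is measured in representations, as in [cstar_mxnorm]. To bound the
    norm of [rho a] in [C] by that of [a] from the definition of a cover would take the
    Gelfand-Naimark theorem. *)
Lemma asym_closed c b :
  (forall e, 0 < e -> exists c' b', [/\ asym c' b', nrm (b - b') <= e &
     forall (K : hilbertType R) (f : C -> K -> K) x, star_rep f ->
       nrm (f c x - f c' x) <= e * nrm x]) -> asym c b.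
Proof.
move=> clo x e e0.
set d := e / (2 * (nrm x + 1) + 2).
have x0 := nrm_ge0 x.
have Dp : 0 < 2 * (nrm x + 1) + 2 by rewrite ltr_wpDl // mulr_ge0 // addr_ge0.
have d0 : 0 < d by rewrite divr_gt0.
have [c' [b' [cb' bb' cc']]] := clo d d0.
have bx : nrm (g b x - g b' x) <= d * nrm x.
  rewrite -(linfB (covrep_linear gc x)).
  by rewrite (le_trans (covrep_contractive gc _ _)) // ler_wpM2r.
(* [V q] is neither contractive nor linear: tolerance 1 bounds |V q x| by |x| + 1, and [tends_nrmB]
   controls the difference of values of [V q]. *)
have := eventually_and (eventually_and (tends_nrm x ltr01) (cb' x d d0))
  (tends_nrmB (g b' x) (g b x) d0).
apply: eventually_mono => q [[h1 h2] h3].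
rewrite subr0 ger0_norm ?nrm_ge0 //.
rewrite subr0 ger0_norm ?nrm_ge0 // in h2.
have n1 : nrm (V q x) <= nrm x + 1.
  by move: h1; rewrite ler_norml => /andP[_]; rewrite lerBlDl.
have n3 : nrm (V q (g b' x) - V q (g b x)) <= d * nrm x + d.
  move: h3; rewrite ler_norml => /andP[_]; rewrite lerBlDl => h3.
  by rewrite (le_trans h3) // lerD2r nrmC.
have n2 := le_trans (cc' _ _ (V q x) (ap_star_rep q)) (ler_wpM2l (ltW d0) n1).
rewrite (le_trans (nrm_trans (sg q c' (V q x)) _ _)) //.
have n4 := le_trans (nrm_trans (V q (g b' x)) (sg q c' (V q x)) (V q (g b x)))
  (lerD h2 n3).
have dE : d * (2 * (nrm x + 1) + 2) = e by rewrite /d divfK // gt_eqF.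
by apply: le_trans (lerD n2 n4) _; rewrite -dE; lra.
Qed.

(** In the limit, |g b x| = |V (g b x)| = |sg c (V x)| <= |c| |V x| = |c| |x|. *)
Lemma asym_nrm c b x : asym c b -> nrm (g b x) <= nrm c * nrm x.
Proof.
move=> cb.
have h := tendsD (tendsZ (nrm c) (tends_nrm x)) (cb x); rewrite addr0 in h.
apply: tends_le (tends_nrm (g b x)) h => q.
have := nrmD (V q (g b x) - sg q c (V q x)) (sg q c (V q x)).
rewrite subrK nrmC addrC => hq; apply: le_trans hq _; rewrite lerD //.
exact: star_rep_contractive (ap_star_rep q).
Qed.

(* Expand the sum of |sg (rho a_i) V x - V (g (eps a_i) x)|^2: the cross terms
   and the last squares are prescribed in the limit, and contractivity bounds
   the first squares, so that the sum is at most |x|^2 - 2 |x|^2 + |x|^2. *)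
Lemma asym_column m (a : 'I_m -> TA) :
  (forall (K : hilbertType R) (f : C -> K -> K) y, star_rep f ->
    \sum_i nrm (f (rho (a i)) y) ^+ 2 <= nrm y ^+ 2) ->
  (forall y, \sum_i nrm (g (eps (a i)) y) ^+ 2 = nrm y ^+ 2) ->
  forall i, asym (rho (a i)) (eps (a i)).
Proof.
move=> ca ga i x.
apply: (@vanishes_sqr _ (fun q => nrm (V q x) ^+ 2
  + - 2 * (\sum_k rdot (sg q (rho (a k)) (V q x)) (V q (g (eps (a k)) x)))
  + \sum_k nrm (V q (g (eps (a k)) x)) ^+ 2)) => [q|].
  pose F k := nrm (sg q (rho (a k)) (V q x) - V q (g (eps (a k)) x)) ^+ 2.
  apply: (@le_trans _ _ (\sum_k F k)).
    by rewrite (bigD1 i) //= lerDl sumr_ge0 // => k _; exact: sqr_ge0.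
  rewrite (le_trans _ (lerD (lerD (ca _ _ (V q x) (ap_star_rep q)) (lexx _))
    (lexx _))) //.
  rewrite mulr_sumr -!big_split ler_sum //= => k _.
  by rewrite /F nrm2B mulNr.
rewrite [X in tends _ X](_ : _ = nrm x ^+ 2
    + - 2 * (\sum_k rdot (g (eps (a k)) x) (g (eps (a k)) x))
    + \sum_k nrm (g (eps (a k)) x) ^+ 2); last first.
  under eq_bigr => k _ do rewrite rdot_nrm.
  by rewrite ga; ring.
have t1 := tends_sum (fun k => tends_nrm2 (g (eps (a k)) x)).
have t2 := tends_sum (fun k => tends_test (a k) x (g (eps (a k)) x)).
exact: tendsD (tendsD (tends_nrm2 x) (tendsZ _ t2)) t1.
Qed.

(** The expansion of [asym_column] for the adjoints. The cross term of [star (rho (a k))] applied to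
    [V x] with [V] of [g (star (eps (a k))) x] is a coefficient of [a k], hence prescribed although
    [star (eps (a k))] need not lie in the tensor algebra. *)
Lemma asym_row m (a : 'I_m -> TA) :
  (forall (K : hilbertType R) (f : C -> K -> K) y, star_rep f ->
    nrm (\sum_i f (rho (a i)) (y i)) ^+ 2 <= sqnorm y) ->
  (forall y, \sum_i g (eps (a i)) (g (star (eps (a i))) y) = y) ->
  forall i, asym (star (rho (a i))) (star (eps (a i))).
Proof.
move=> ra ga i x.
have gE k : rdot (g (eps (a k)) (g (star (eps (a k))) x)) x =
    nrm (g (star (eps (a k))) x) ^+ 2.
  by rewrite (rdot_adj _ _ (covrep_is_adjoint gc _)) rdot_nrm.
have gS : \sum_k nrm (g (star (eps (a k))) x) ^+ 2 = nrm x ^+ 2.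
  by under eq_bigr => k _ do rewrite -gE; rewrite -rdot_suml ga rdot_nrm.
apply: (@vanishes_sqr _ (fun q => nrm (V q x) ^+ 2
  + - 2 * (\sum_k rdot (sg q (rho (a k)) (V q (g (star (eps (a k))) x))) (V q
    x))
  + \sum_k nrm (V q (g (star (eps (a k))) x)) ^+ 2)) => [q|].
  have [_ sa] := ap_star_rep q.
  pose u k := sg q (star (rho (a k))) (V q x).
  pose v k := V q (g (star (eps (a k))) x).
  have uE k y : rdot (u k) y = rdot (V q x) (sg q (rho (a k)) y).
    by rewrite (rdot_adj _ _ (is_adjoint_sym (sa _))).
  (* The adjoint of a contractive row is contractive: expand |V x - y|^2 >= 0 and use |y|^2 <=
     [sqnorm u]. *)
  have us : sqnorm u <= nrm (V q x) ^+ 2.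
    pose y := \sum_k sg q (rho (a k)) (u k).
    have h1 := ra _ _ u (ap_star_rep q); have := sqr_ge0 (nrm (V q x - y)).
    rewrite nrm2B rdot_sumr; under eq_bigr => k _ do rewrite -uE rdot_nrm.
    by rewrite -/(sqnorm u); move: h1; rewrite -/y; lra.
  apply: (@le_trans _ _ (\sum_k nrm (u k - v k) ^+ 2)).
    by rewrite (bigD1 i) //= lerDl sumr_ge0 // => k _; exact: sqr_ge0.
  rewrite (le_trans _ (lerD (lerD us (lexx _)) (lexx _))) //.
  rewrite mulr_sumr -!big_split ler_sum //= => k _.
  by rewrite nrm2B uE rdotC mulNr.
rewrite [X in tends _ X](_ : _ = nrm x ^+ 2
    + - 2 * (\sum_k rdot (g (eps (a k)) (g (star (eps (a k))) x)) x)
    + \sum_k nrm (g (star (eps (a k))) x) ^+ 2); last first.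
  by under eq_bigr => k _ do rewrite gE; rewrite gS; ring.
have t1 := tends_sum (fun k => tends_nrm2 (g (star (eps (a k))) x)).
have t2 := tends_sum (fun k => tends_test (a k) (g (star (eps (a k))) x) x).
exact: tendsD (tendsD (tends_nrm2 x) (tendsZ _ t2)) t1.
Qed.

(** Inherited through complete isometry. As [mxnorm] measures square matrices, the row becomes the
    top row of a matrix padded by zeros, whose norm is computed in covariant representations, where
    the row is coisometric. *)
Lemma cover_row_contraction m (a : 'I_m -> TA) (K : hilbertType R)
    (f : C -> K -> K) y : star_rep f ->
  \sum_i eps (a i) ** star (eps (a i)) = j one ->
  nrm (\sum_i f (rho (a i)) (y i)) ^+ 2 <= sqnorm y.
Proof.
case: m a y => [|m] a y fs a1.
  by rewrite big_ord0 nrm0 expr0n sqnorm_ge0.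
pose M : 'M[TA]_m.+1 := \matrix_(i, l) if i == ord0 then a l else 0.
have ME (K' : hilbertType R) (phi : TA -> K' -> K') z : cc_rep phi ->
    sqnorm (mxact (map_mx phi M) z) = nrm (\sum_i phi (a i) (z i)) ^+ 2.
  move=> cphi; rewrite /sqnorm (bigD1 ord0) //= big1 ?addr0 => [|i i0].
    congr (nrm _ ^+ 2); apply: eq_bigr => l _.
    by rewrite !mxE.
  rewrite /mxact big1 ?nrm0 ?expr0n // => l _.
  by rewrite !mxE (negbTE i0) (linf0 (cc_rep_linearl cphi _)).
have cf := cover_cc_rep fs.
have := cc_rep_mx_bound cf M y; rewrite (ME _ _ _ cf) => h.
rewrite (le_trans h) // ler_piMl ?sqnorm_ge0 // -[leRHS](expr1n _ 2).
have M1 : mxnorm m.+1 M <= 1.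
  apply: tensor_mxnorm_le => // H' f' g' fg'; have [cf' gc' _ _] := fg'.
  apply: opmx_le => // z; rewrite ME // expr1n mul1r (matching_incl fg').
  apply: (@row_contraction _ _ _ (fun i => g' (eps (a i)))
    (fun i => g' (star (eps (a i))))) => [i|x].
    exact: covrep_is_adjoint gc' _.
  rewrite -[RHS](covrep_unit gc') -a1 (linf_sum (covrep_linear gc' x)).
  by apply: eq_bigr => i _; rewrite (covrepM gc').
rewrite ler_sqr ?nnegrE //.
exact: le_trans (opmx_ge0 _) (cf.2 _ M).
Qed.

Lemma gram_column m (a : 'I_m -> B) (H' : hilbertType R) (g' : B -> H' ->
  H') x :
  covrep g' -> \sum_i star (a i) ** a i = j one ->
  \sum_i nrm (g' (a i) x) ^+ 2 = nrm x ^+ 2.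
Proof.
move=> gc' a1; rewrite -[RHS]rdot_nrm -{3}(covrep_unit gc' x) -a1.
rewrite (linf_sum (covrep_linear gc' x)) rdot_sumr; apply: eq_bigr => i _.
by rewrite (covrepM gc') -(rdot_adj _ _ (covrep_is_adjoint gc' _)) rdot_nrm.
Qed.

Lemma cover_column_contraction m (a : 'I_m -> TA) (K : hilbertType R)
    (f : C -> K -> K) y : star_rep f ->
  \sum_i star (eps (a i)) ** eps (a i) = j one ->
  \sum_i nrm (f (rho (a i)) y) ^+ 2 <= nrm y ^+ 2.
Proof.
case: m a => [|m] a fs a1.
  by rewrite big_ord0 sqr_ge0.
pose M : 'M[TA]_m.+1 := \matrix_(i, l) if l == ord0 then a i else 0.
have ME (K' : hilbertType R) (phi : TA -> K' -> K') z : cc_rep phi ->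
    sqnorm (mxact (map_mx phi M) z) = \sum_i nrm (phi (a i) (z ord0)) ^+ 2.
  move=> cphi; apply: eq_bigr => i _; congr (nrm _ ^+ 2).
  rewrite /mxact (bigD1 ord0) //= !mxE eqxx big1 ?addr0 // => l l0.
  by rewrite !mxE (negbTE l0) (linf0 (cc_rep_linearl cphi _)).
have cf := cover_cc_rep fs.
pose z i := if i == ord0 :> 'I_m.+1 then y else 0.
have z1 : sqnorm z = nrm y ^+ 2.
  rewrite /sqnorm (bigD1 ord0) //= big1 ?addr0 // => i i0.
  by rewrite /z (negbTE i0) nrm0 expr0n.
have := cc_rep_mx_bound cf M z; rewrite (ME _ _ _ cf) => h.
rewrite (le_trans h) // z1 ler_piMl ?sqr_ge0 // -[leRHS](expr1n _ 2).
have M1 : mxnorm m.+1 M <= 1.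
  apply: tensor_mxnorm_le => // H' f' g' fg'; have [cf' gc' _ _] := fg'.
  apply: opmx_le => // w; rewrite ME // expr1n mul1r (matching_incl fg').
  rewrite (gram_column _ gc' a1) /sqnorm (bigD1 ord0) //= lerDl.
  by rewrite sumr_ge0 // => i _; rewrite sqr_ge0.
rewrite ler_sqr ?nnegrE //.
exact: le_trans (opmx_ge0 _) (cf.2 _ M).
Qed.

Lemma asym_isometric_column m (a : 'I_m -> TA) i :
  \sum_k star (eps (a k)) ** eps (a k) = j one -> asym (rho (a i)) (eps (a i)).
Proof.
move=> a1; apply: asym_column => [K f y fs|y].
  exact: cover_column_contraction.
exact: gram_column.
Qed.

Lemma asym_coisometric_row m (a : 'I_m -> TA) i :
  \sum_k eps (a k) ** star (eps (a k)) = j one ->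
  asym (star (rho (a i))) (star (eps (a i))).
Proof.
move=> a1; apply: asym_row => [K f y fs|y].
  exact: cover_row_contraction.
rewrite -[RHS](covrep_unit gc) -a1 (linf_sum (covrep_linear gc y)).
by apply: eq_bigr => k _; rewrite (covrepM gc).
Qed.

(** Intertwining by an isometry does not pass to adjoints; carrying [star c] along makes the related
    pairs a star-algebra. *)
Definition biasym (c : C) (b : B) : Prop := asym c b /\ asym (star c) (star b).

Lemma asym0 : asym 0 0.
Proof.
move=> x; rewrite (linf0 (covrep_linear gc x)).
have := tends_nrm 0; rewrite nrm0; apply: tends_ext => q.
by rewrite (linf0 (rep_linearl _ (ap_star_rep q).1)) sub0r nrmN.
Qed.

Lemma biasym0 : biasym 0 0.
Proof. by split; rewrite ?star0; exact: asym0. Qed.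

Lemma biasym_lin (a : R[i]) c b c' b' :
  biasym c b -> biasym c' b' -> biasym (a *: c + c') (a *: b + b').
Proof.
by move=> [h1 h2] [h3 h4]; split; rewrite ?starDZ; exact: asym_lin.
Qed.

Lemma biasymM c b c' b' :
  biasym c b -> biasym c' b' -> biasym (c ** c') (b ** b').
Proof.
by move=> [h1 h2] [h3 h4]; split; rewrite ?star_bmul; exact: asymM.
Qed.

Lemma biasym_star c b : biasym c b -> biasym (star c) (star b).
Proof. by move=> [h1 h2]; split; rewrite ?starK. Qed.

Lemma biasym_closed c b :
  (forall e, 0 < e -> exists c' b', [/\ biasym c' b', nrm (b - b') <= e &
     forall (K : hilbertType R) (f : C -> K -> K) x, star_rep f ->
       nrm (f (c - c') x) <= e * nrm x]) -> biasym c b.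
Proof.
move=> clo; split; apply: asym_closed => e e0;
    have [c' [b' [[h1 h2] bb' cc']]] := clo e e0.
  exists c', b'; split => // K f x fs.
  by rewrite -(linfB (rep_linearl _ fs.1)) cc'.
exists (star c'), (star b'); split => //; first by rewrite -starB nrm_star.
move=> K f x fs; rewrite -(linfB (rep_linearl _ fs.1)) -starB.
by apply: adjoint_bound (fs.2 _) (ltW e0) _ => y; exact: cc'.
Qed.

Lemma biasym_t i : biasym (rho (t i)) (s i).
Proof.
rewrite -tensor_incl_t; split.
  apply: (@asym_isometric_column 1 (fun=> t i) ord0).
  by rewrite big_ord1 tensor_incl_t stacey_isometry.
(* A single [t i] suffices as a column, but only all of them together form a coisometric row. *)
apply: (@asym_coisometric_row n t i).
apply: stacey_ext => H' g' gc' h; rewrite (covrep_unit gc').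
rewrite (linf_sum (covrep_linear gc' h)) -[RHS](covrep_cuntz gc' h).
by apply: eq_bigr => k _; rewrite tensor_incl_t (covrepM gc').
Qed.

Lemma iota_linear : linear iota.
Proof.
move=> a x y; apply: tensor_ext => H' f' g' fg' h.
have [[[_ l _] _] gc' fj _] := fg'.
by rewrite l !fj stacey_j_linear (covrep_linear gc').
Qed.

Lemma biasym_iota x : biasym (rho (iota x)) (j x).
Proof.
have small y : nrm y < 1 -> biasym (rho (iota y)) (j y).
  (* y is completed to an isometric column by d, and to a coisometric row. *)
  move=> y1; rewrite -tensor_incl_iota; split.
    have [d dE] := unit_complement hone y1.
    apply: (@asym_isometric_column 2 (fun i =>
      iota (if i == ord0 then y else d)) ord0).
    rewrite 2!big_ord_recl big_ord0 /= addr0 !tensor_incl_iota.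
    by rewrite -!stacey_j_star -!stacey_jM -(linfD stacey_j_linear) dE.
  have sy1 : nrm (star y) < 1 by rewrite nrm_star.
  have [d dE] := unit_complement hone sy1.
  (* The defect of [star y] gives [y ** star y + star d ** d = one], so the row is made of [y] and
     [star d]. *)
  apply: (@asym_coisometric_row 2
    (fun i => iota (if i == ord0 then y else star d)) ord0).
  rewrite 2!big_ord_recl big_ord0 /= addr0 !tensor_incl_iota.
  rewrite -!stacey_j_star -!stacey_jM -(linfD stacey_j_linear) starK.
  by rewrite -dE starK.
(* Adding 1 makes the rescaled norm strictly less than 1 and covers [x = 0]; the [+ 0] below gives
   the shape of [biasym_lin]. *)
set c := nrm x + 1; have c0 : 0 < c by rewrite ltr_wpDl ?nrm_ge0.
have xE : x = c%:C *: ((c^-1)%:C *: x) + 0.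
  by rewrite addr0 scalerA -rmorphM /= mulfV ?gt_eqF // scale1r.
have [[lr _] _ _] := hrho.
rewrite {1 2}xE iota_linear lr stacey_j_linear; apply: biasym_lin.
  apply: small; rewrite nrmZr gtr0_norm ?invr_gt0 // mulrC ltr_pdivrMr // mul1r.
  by rewrite ltrDl.
rewrite (linf0 iota_linear) (linf0 lr) (linf0 stacey_j_linear); exact: biasym0.
Qed.

Lemma biasym_tensor a : biasym (rho a) (eps a).
Proof.
have [gen _ _] := hTA; have [[lr mr] _ _] := hrho.
have [le me] := tensor_incl_hom.
apply: (opalg_generated_ind (P := fun a => biasym (rho a) (eps a)) gen).
- move=> x cx; apply: biasym_closed => e /cx [y hy xy].
  exists (rho y), (eps y); split => //.
    by rewrite (le_trans (corr_nrm (tensor_inclP _) (tensor_inclP _))) // ltW.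
  move=> K f z fs; rewrite -(linfB lr).
  rewrite (le_trans (cc_rep_nrm _ _ (cover_cc_rep fs))) //.
  by rewrite ler_wpM2r ?nrm_ge0 // ltW.
- split; first by rewrite (linf0 lr) (linf0 le); exact: biasym0.
    by move=> c x y hx hy; rewrite lr le; exact: biasym_lin.
  by move=> x y hx hy; rewrite mr me; exact: biasymM.
- move=> _ [[x _ <-]|[mu _ <-]].
    by rewrite tensor_incl_iota; exact: biasym_iota.
  elim: mu => [|i mu ih] /=.
    by rewrite tensor_incl_iota; exact: biasym_iota.
  by rewrite mr me tensor_incl_t; apply: biasymM => //; exact: biasym_t.
Qed.

End Asymptotics.

(** * The star-homomorphism from a cover onto [B] *)

Definition cover_rel (c : C) (b : B) : Prop :=
  forall (H : hilbertType R) (g : B -> H -> H), covrep g -> biasym (g := g) c b.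

(** [asym_nrm] bounds [g (b - b')] for each covariant [g]; since [cover_rel] holds for all of them
    at once, the supremum gives the norm of [B]. *)
Lemma cover_rel_nrm c b c' b' : cover_rel c b -> cover_rel c' b' ->
  nrm (b - b') <= nrm (c - c').
Proof.
move=> cb cb'; apply: stacey_nrm_le => [|H g gc h]; first exact: nrm_ge0.
have := (biasym_lin gc (-1) (cb' _ _ gc) (cb _ _ gc)).1.
by rewrite !scaleN1r ![- _ + _]addrC; exact: asym_nrm.
Qed.

Lemma cover_rel_fun c b b' : cover_rel c b -> cover_rel c b' -> b = b'.
Proof.
move=> cb cb'; apply/eqP; rewrite -subr_eq0; apply/eqP/nrm0_eq0/eqP.
by rewrite eq_le nrm_ge0 (le_trans (cover_rel_nrm cb cb')) // subrr nrm0.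
Qed.

Lemma cover_rel_total c : exists b, cover_rel c b.
Proof.
have [_ _ gen] := hrho; pose S c := exists b, cover_rel c b.
rewrite -/(S c); suff -> : S = setT by [].
apply: gen.
- apply: closed_nrm => x cx; apply: closed_graph_domain cover_rel_nrm _ cx.
  move=> {}x y clo H g gc; apply: (biasym_closed gc) =>
    e /clo [c' [b' [h xc yb]]].
  exists c', b'; split; [exact: h|exact: ltW|move=> K f z fs].
  by rewrite (le_trans (star_rep_contractive _ _ fs)) // ler_wpM2r ?nrm_ge0 //
    ltW.
- split; first split.
  + by exists 0 => H g gc; exact: biasym0.
  + move=> a x y [b xb] [b' yb']; exists (a *: b + b') => H g gc.
    by apply: biasym_lin => //; [exact: xb|exact: yb'].
  + move=> x y [b xb] [b' yb']; exists (b ** b') => H g gc.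
    by apply: biasymM => //; [exact: xb|exact: yb'].
  + by move=> x [b xb]; exists (star b) => H g gc; apply: biasym_star; exact:
    xb.
- by move=> _ [a _ <-]; exists (eps a) => H g gc; exact: biasym_tensor.
Qed.

Definition cover_map (c : C) : B := sval (cid (cover_rel_total c)).

Lemma cover_mapP c : cover_rel c (cover_map c).
Proof. exact: (svalP (cid (cover_rel_total c))). Qed.

Lemma cover_map_rho a : cover_map (rho a) = eps a.
Proof.
apply: cover_rel_fun (cover_mapP _) _ => H g gc; exact: biasym_tensor.
Qed.

Lemma cover_map_star_hom : star_hom cover_map.
Proof.
split; first split.
- move=> a x y; apply: cover_rel_fun (cover_mapP _) _ => H g gc.
  by apply: biasym_lin => //; exact: cover_mapP.
- move=> x y; apply: cover_rel_fun (cover_mapP _) _ => H g gc.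
  by apply: biasymM => //; exact: cover_mapP.
- move=> x; apply: cover_rel_fun (cover_mapP _) _ => H g gc.
  by apply: biasym_star; exact: cover_mapP.
Qed.

(** Each covariant [g] makes [g \o Psi] a representation of [D], hence contractive, and these [g]
    compute the norm of [B]. *)
Lemma star_hom_to_stacey_contractive (D : cstarAlgType R) (Psi : D -> B) c :
  star_hom Psi -> nrm (Psi c) <= nrm c.
Proof.
move=> [[lP mP] sP]; apply: stacey_nrm_le => [|H g gc h]; first exact: nrm_ge0.
apply: (star_rep_contractive (f := g \o Psi)).
have [b l m] := covrep_rep gc; split; first split.
- by move=> x; exact: b.
- by move=> y a x x'; rewrite /= lP l.
- by move=> x y z; rewrite /= mP m.
- by move=> x; rewrite /= sP; exact: covrep_is_adjoint gc _.
Qed.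

Lemma cover_map_onto : range cover_map = setT.
Proof.
have hom := cover_map_star_hom; have [[lP mP] sP] := hom.
have [_ _ gen] := tensor_incl_cover; apply: gen.
- apply: closed_nrm => b; apply: star_hom_closed_range => // c.
  exact: star_hom_to_stacey_contractive.
- split; first split.
  + by exists 0 => //; rewrite (linf0 lP).
  + by move=> a _ _ [x _ <-] [y _ <-]; exists (a *: x + y) => //; rewrite lP.
  + by move=> _ _ [x _ <-] [y _ <-]; exists (x ** y) => //; rewrite mP.
  + by move=> _ [x _ <-]; exists (star x) => //; rewrite sP.
- by move=> _ [a _ <-]; exists (rho a) => //; rewrite cover_map_rho.
Qed.

Lemma cover_map_unique (Psi : C -> B) :
  star_hom Psi -> (forall a, Psi (rho a) = eps a) -> Psi = cover_map.
Proof.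
move=> hP Pr; have hom := cover_map_star_hom; have [[lP mP] sP] := hP.
have [[lM mM] sM] := hom; apply/funext => c.
have [_ _ gen] := hrho; pose S c := Psi c = cover_map c.
rewrite -/(S c); suff -> : S = setT by [].
apply: gen.
- apply: closed_nrm => x cx; apply: nrm_eqP => e e0.
  have e2 : 0 < e / 2 by rewrite divr_gt0.
  have [y Sy xy] := cx _ e2.
  rewrite (le_trans (nrm_trans (Psi y) _ _)) // {2}Sy -(linfB lP) -(linfB lM).
  rewrite (splitr e) lerD // (le_trans (star_hom_to_stacey_contractive _ _)) //
    ltW //.
  by rewrite nrmC.
- split; first split.
  + by rewrite /S (linf0 lP) (linf0 lM).
  + by move=> a x y Sx Sy; rewrite /S lP lM Sx Sy.
  + by move=> x y Sx Sy; rewrite /S mP mM Sx Sy.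
  + by move=> x Sx; rewrite /S sP sM Sx.
- by move=> _ [a _ <-]; rewrite /S Pr cover_map_rho.
Qed.

End Cover.

Lemma tensor_incl_envelope : cstar_envelope eps.
Proof.
split; first exact: tensor_incl_cover.
move=> C rho hrho; exists (cover_map hrho); split.
  by split; [exact: cover_map_star_hom|exact: cover_map_onto|exact:
    cover_map_rho].
by move=> Psi [hP _ Pr]; rewrite (cover_map_unique hrho hP Pr).
Qed.

End CovariantReps.

(** * Uniqueness of the C*-envelope *)

Lemma star_hom_comp (R : realType) (A B C : cstarAlgType R) (f : B -> C)
    (g : A -> B) : star_hom f -> star_hom g -> star_hom (f \o g).
Proof.
move=> [[lf mf] sf] [[lg mg] sg]; split; first split.
- by move=> a x y; rewrite /= lg lf.
- by move=> x y; rewrite /= mg mf.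
- by move=> x; rewrite /= sg sf.
Qed.

(** Each envelope is a cover, which gives maps both ways. The composites fix the copy of [T], and
    the uniqueness clause, with an envelope as its own cover, makes them identities. *)
Lemma cstar_envelope_unique (R : realType) (T : opAlgType R)
    (E1 E2 : cstarAlgType R) (e1 : T -> E1) (e2 : T -> E2) :
  cstar_envelope e1 -> cstar_envelope e2 ->
  exists Phi : E1 -> E2,
    [/\ star_hom Phi, bijective Phi & forall a, Phi (e1 a) = e2 a].
Proof.
have self (E : cstarAlgType R) (e : T -> E) (Psi : E -> E) : cstar_envelope e ->
    star_hom Psi -> range Psi = setT -> (forall a, Psi (e a) = e a) ->
    forall x, Psi x = x.
  move=> [ce ue] hP rP Pe x; have [P0 [_ uniq]] := ue _ _ ce.
  rewrite -(uniq Psi) // -[RHS]/(@id E x) -(uniq id) //; split => //.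
  by rewrite image_id.
move=> env1 env2; have [c1 u1] := env1; have [c2 u2] := env2.
have [Phi [[hPhi rPhi ePhi] _]] := u2 _ _ c1.
have [Psi [[hPsi rPsi ePsi] _]] := u1 _ _ c2.
have onto (X Y Z : Type) (f : Y -> Z) (g : X -> Y) :
    range f = setT -> range g = setT -> range (f \o g) = setT.
  move=> rf rg; apply/seteqP; split => // z _.
  have [y _ <-] : range f z by rewrite rf.
  have [x _ <-] : range g y by rewrite rg.
  by exists x.
exists Phi; split => //; exists Psi.
  apply: (self _ e1 (Psi \o Phi)) => //; first exact: star_hom_comp.
    exact: onto.
  by move=> a; rewrite /= ePhi ePsi.
apply: (self _ e2 (Phi \o Psi)) => //; first exact: star_hom_comp.
  exact: onto.
by move=> a; rewrite /= ePsi ePhi.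
Qed.

Theorem theorem3p13 (R : realType) (A : cstarAlgType R)
    (one : A) (hone : is_unit one)
    (alpha : A -> A) (halpha : star_hom alpha) (halpha1 : alpha one = one)
    (n : nat) (hn : (1 <= n)%N)
    (TA : opAlgType R) (iota : A -> TA) (t : 'I_n -> TA)
    (hTA : tensor_crossed_product one alpha iota t)
    (B : cstarAlgType R) (j : A -> B) (s : 'I_n -> B)
    (hB : stacey_crossed_product one alpha j s) :
  (exists (E : cstarAlgType R) (eps : TA -> E), cstar_envelope eps) /\
  (forall (E : cstarAlgType R) (eps : TA -> E), cstar_envelope eps ->
     exists Phi : E -> B,
       [/\ star_hom Phi, bijective Phi,
           forall x, Phi (eps (iota x)) = j x
         & forall i, Phi (eps (t i)) = s i]).
Proof.
have env := tensor_incl_envelope hone halpha1 hTA hB.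
split; first by exists B, (tensor_incl hTA hB).
move=> E e envE; have [Phi [hPhi bPhi ePhi]] := cstar_envelope_unique envE env.
exists Phi; split => // [x|i]; rewrite ePhi.
  exact: tensor_incl_iota.
exact: tensor_incl_t.
Qed.
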